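(* For every real $p \ge 2$, \[ \gamma_p \le \inf_{0 < \theta < \pi/2}\left(\frac{1 + \sin\theta}{2\sin\theta}\log_2\frac{1 + \sin\theta}{2\sin\theta} - \frac{1 - \sin\theta}{2\sin\theta}\log_2\frac{1 - \sin\theta}{2\sin\theta}+\frac{2}{p}\log_2\sin\frac{\theta}{2}\right), \] where $\gamma_p = \limsup_{n\to\infty} \frac1n \log_2 \Delta_p(n)$ and $\Delta_p(n)$ is the maximum translative packing density of unit $\ell_p$-balls in $\mathbb{R}^n$. In particular, $\gamma_p < -1/p$ for all real $p \ge 2$.
   Context: For real $p \ge 1$ and $\bm{x} = (x_1,\dots,x_n) \in \mathbb{R}^n$, $\|\bm{x}\|_p := (|x_1|^p + \cdots + |x_n|^p)^{1/p}$, and the unit $\ell_p$-ball is $\bm{B}_p^n := \{\bm{x} \in \mathbb{R}^n : \|\bm{x}\|_p \le 1\}$. A translative packing of $\bm{B}_p^n$ is a family $\{\bm{x} + \bm{B}_p^n : \bm{x} \in X\}$, with $X \subseteq \mathbb{R}^n$, of translates with pairwise disjoint interiors (equivalently, $\|\bm{x}-\bm{y}\|_p \ge 2$ for all distinct $\bm{x},\bm{y} \in X$); rotations are not allowed. Its density is the fraction of space occupied by the balls, i.e. the upper density $\limsup_{R\to\infty} (2R)^{-n}\,\mathrm{vol}\big([-R,R]^n \cap \bigcup_{\bm{x}\in X}(\bm{x}+\bm{B}_p^n)\big)$. $\Delta_p(n)$ denotes the maximum (supremum) of the density over all translative packings of $\bm{B}_p^n$ in $\mathbb{R}^n$. *)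

(* Defs.v *)
From HB Require Import structures.
From mathcomp Require Import all_boot all_order all_algebra.
From mathcomp Require Import all_classical all_reals all_analysis.

Set Implicit Arguments.
Unset Strict Implicit.
Unset Printing Implicit Defensive.
Import Order.TTheory GRing.Theory Num.Theory.
Import numFieldNormedType.Exports.

Local Open Scope classical_set_scope.
Local Open Scope ring_scope.

(* MathComp-Analysis has a product sigma-algebra on n.-tuple but no Lebesgue
   measure there: it is built by recursion on n as an iterated binary product,
   transported along (x, t) |-> x :: t; see lebesgue_tuple_box below. *)

Definition tuple_of_pair (R : realType) (n : nat)
    (z : measurableTypeR R * n.-tuple (measurableTypeR R)) :
    n.+1.-tuple (measurableTypeR R) :=
  [the n.+1.-tuple _ of z.1 :: z.2].

Lemma measurable_tuple_of_pair (R : realType) (n : nat) :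
  measurable_fun setT (@tuple_of_pair R n).
Proof. exact: measurable_cons. Qed.

Section lebesgue_tupleS.
Local Open Scope ereal_scope.
Context (R : realType) (n : nat).
Variable mu : {sigma_finite_measure set (n.-tuple (measurableTypeR R)) -> \bar R}.

Definition lebesgue_tupleS : set (n.+1.-tuple (measurableTypeR R)) -> \bar R :=
  pushforward (lebesgue_measure \x mu) (@tuple_of_pair R n).

Let measurable_preim (A : set (n.+1.-tuple (measurableTypeR R))) :
  measurable A -> measurable (@tuple_of_pair R n @^-1` A).
Proof.
by move=> mA; rewrite -[X in measurable X]setTI; exact: measurable_tuple_of_pair.
Qed.

Let lebesgue_tupleS0 : lebesgue_tupleS set0 = 0.
Proof. by rewrite /lebesgue_tupleS /pushforward preimage_set0 measure0. Qed.

Let lebesgue_tupleS_ge0 A : 0 <= lebesgue_tupleS A.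
Proof. exact: (measure_ge0 (lebesgue_measure \x mu)). Qed.

Let lebesgue_tupleS_sigma_additive : semi_sigma_additive lebesgue_tupleS.
Proof.
move=> F mF tF mUF; rewrite /lebesgue_tupleS /pushforward preimage_bigcup.
apply: measure_semi_sigma_additive.
- by move=> k; exact: measurable_preim.
- apply/trivIsetP => /= i j _ _ ij; rewrite -preimage_setI.
  by move/trivIsetP : tF => /(_ _ _ _ _ ij) ->//; rewrite preimage_set0.
- by rewrite -preimage_bigcup; exact: measurable_preim.
Qed.

HB.instance Definition _ := isMeasure.Build _ _ _ lebesgue_tupleS
  lebesgue_tupleS0 lebesgue_tupleS_ge0 lebesgue_tupleS_sigma_additive.

Let lebesgue_tupleS_sigma_finite : sigma_finite setT lebesgue_tupleS.
Proof.
have /sigma_finiteP[F [TF ndF Foo]] := sigma_finiteT (@lebesgue_measure R).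
have /sigma_finiteP[G [TG ndG Goo]] := sigma_finiteT mu.
pose g (t : n.+1.-tuple (measurableTypeR R)) :
  measurableTypeR R * n.-tuple (measurableTypeR R) := (thead t, [tuple of behead t]).
have mg : measurable_fun setT g.
  apply/measurable_fun_pairP; split; first exact: measurable_tnth.
  exact: measurable_behead.
have gK z : g (tuple_of_pair z) = z.
  by case: z => x t; rewrite /g /tuple_of_pair/= theadE; congr pair; exact: val_inj.
exists (fun k => g @^-1` (F k `*` G k)) => [|k].
  rewrite -preimage_bigcup (_ : \bigcup_k _ = setT) ?preimage_setT//.
  apply/seteqP; split=> // -[x t] _.
  have [i _ Fx] : (\bigcup_k F k) x by rewrite -TF.
  have [j _ Gt] : (\bigcup_k G k) t by rewrite -TG.
  exists (maxn i j) => //; split => /=.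
    by move: Fx; exact/subsetPset/ndF/leq_maxl.
  by move: Gt; exact/subsetPset/ndG/leq_maxr.
have [mF Fk] := Foo k; have [mG Gk] := Goo k; split.
  by rewrite -[X in measurable X]setTI; apply: mg => //; exact: measurableX.
rewrite /lebesgue_tupleS /pushforward (_ : _ @^-1` _ = F k `*` G k).
  by rewrite product_measure1E// lte_mul_pinfty// ge0_fin_numE.
by rewrite -comp_preimage (_ : g \o _ = id)//; apply/funext => z; exact: gK.
Qed.

HB.instance Definition _ := Measure_isSigmaFinite.Build _ _ _ lebesgue_tupleS
  lebesgue_tupleS_sigma_finite.

End lebesgue_tupleS.

Fixpoint lebesgue_tuple (R : realType) (n : nat) :
    {sigma_finite_measure set (n.-tuple (measurableTypeR R)) -> \bar R} :=
  match n with
  | 0 => @dirac _ _ ([tuple] : 0.-tuple (measurableTypeR R)) R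
  | m.+1 => lebesgue_tupleS (lebesgue_tuple R m)
  end.

Lemma lebesgue_tuple_box (R : realType) (n : nat)
    (A : 'I_n -> set (measurableTypeR R)) : (forall i, measurable (A i)) ->
  lebesgue_tuple R n [set t | forall i, A i (tnth t i)] =
  (\prod_(i < n) lebesgue_measure (A i))%E.
Proof.
elim: n A => [|n IH] A mA.
  by rewrite big_ord0 /= diracE mem_set// => -[].
rewrite big_ord_recl/= /lebesgue_tupleS /pushforward.
rewrite (_ : _ @^-1` _ = A ord0 `*`
    [set t : n.-tuple (measurableTypeR R) | forall i, A (lift ord0 i) (tnth t i)]).
  rewrite product_measure1E//.
    by congr (_ * _)%E; exact: (IH (fun i => A (lift ord0 i))).
  rewrite (_ : [set _ | _] = \bigcap_(i in [set: 'I_n])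
     ((@tnth n (measurableTypeR R) ^~ i) @^-1` A (lift ord0 i))); last first.
    by apply/seteqP; split=> t /= h i => [_|]; exact: h.
  apply: fin_bigcap_measurable => [|i _]; first exact: finite_finset.
  by rewrite -[X in measurable X]setTI; exact: measurable_tnth.
apply/seteqP; split=> -[x t] /=.
  move=> h; split; first exact: (h ord0).
  by move=> i; have := h (lift ord0 i); rewrite tnthS.
move=> [h0 h] i; have [->//|i0] := eqVneq i ord0.
case: (unliftP ord0 i) i0 => [j ->|->]; last by rewrite eqxx.
by rewrite tnthS.
Qed.

Definition vol (R : realType) (n : nat) (A : set 'rV[R]_n) : \bar R :=
  lebesgue_tuple R n [set t | A (\row_i tnth t i)].

Definition lpnorm (R : realType) (p : R) (n : nat) (x : 'rV[R]_n) : R :=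
  (\sum_(i < n) `|x ord0 i| `^ p) `^ p^-1.

Definition lpball (R : realType) (p : R) (n : nat) : set 'rV[R]_n :=
  [set x | lpnorm p x <= 1].
Arguments lpball {R} p n.

Definition translate (R : realType) (n : nat) (x : 'rV[R]_n) (A : set 'rV[R]_n) :
  set 'rV[R]_n := [set x + y | y in A].

Definition packing (R : realType) (p : R) (n : nat) (X : set 'rV[R]_n) : Prop :=
  trivIset X (fun x => interior (translate x (lpball p n))).

Definition cube (R : realType) (n : nat) (r : R) : set 'rV[R]_n :=
  [set x | forall i, - r <= x ord0 i <= r].
Arguments cube {R} n r.

Definition density (R : realType) (p : R) (n : nat) (X : set 'rV[R]_n) : \bar R :=
  limf_esup (fun r : R => (((2 * r) ^- n)%:E *
      vol (cube n r `&` \bigcup_(x in X) translate x (lpball p n)))%E)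
    +oo.

(* The paper's Delta_p(n). *)
Definition max_density (R : realType) (p : R) (n : nat) : \bar R :=
  ereal_sup [set density p X | X in @packing R p n].

Definition log2 (R : realType) (x : R) : R := ln x / ln 2.

(* log2 with values in \bar R, so that log2e 0 = -oo. *)
Definition log2e (R : realType) (x : \bar R) : \bar R :=
  (lne x * ((ln 2)^-1)%:E)%E.

Definition gamma (R : realType) (p : R) : \bar R :=
  limn_esup (fun n : nat => ((n%:R^-1)%:E * log2e (max_density p n))%E).

(* Main.v *)
(** A dilation by [r] of the unit [l_p]-ball multiplies volumes by [r^n], so averaging over all
    positions shows that if every [l_p]-ball of radius [r] contains at most [B] centres, then the
    density is at most [B / r^n].  For [p >= 2] the coordinatewise map
    [a |-> sgn a * |a|^(p/2)] sends points at [l_p]-distance at least 2 to points at Euclidean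
    distance at least 2, and an [l_p]-ball of radius [sin(theta/2)^(-2/p)] into a Euclidean ball of
    radius [1 / sin(theta/2)]; lifting the latter to a sphere one dimension higher yields a spherical
    code of angle [theta].

    Spherical codes are bounded by Delsarte's method (Kabatianskii and Levenshtein).  With [sigma_i]
    the Gegenbauer polynomials normalised by [sigma_i 1 = 1], take [g = sum_i v_i sigma_i] with
    [v >= 0] and [(t - s) g(t) = sum_i w_i sigma_i(t)] with [w >= eps * v], and sum
    [(t - s) g(t)^2] over all pairs of code points.  The off-diagonal terms are nonpositive, while
    positive definiteness of the [sigma_i] and a rank bound for the Gram matrix of [sigma_i] bound the
    sum from below by [eps * |C|^2 * sum_i v_i^2 / D_i], where [D_i] is the number of monomials of
    degree [i].  Such a [v], supported on a window of bounded length starting at [rho * n], exists as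
    soon as [s < 2 sqrt (rho (1 + rho)) / (1 + 2 rho)], that is, when
    [rho > (1 - sin theta) / (2 sin theta)] for [s = cos theta], and then [D_i] grows like the
    binomial ['C((1 + rho) n, n)]. *)

Require Import Defs.
From mathcomp Require Import all_boot all_order all_algebra.
From mathcomp Require Import all_classical all_reals all_analysis.
From mathcomp Require Import measurable_realfun.
From mathcomp Require Import ring lra zify.
From mathcomp Require Import -(notations) mpoly.

Set Implicit Arguments.
Unset Strict Implicit.
Unset Printing Implicit Defensive.
Import Order.TTheory GRing.Theory Num.Theory.
Import numFieldNormedType.Exports.
Local Open Scope classical_set_scope.
Local Open Scope ring_scope.

(** * Gegenbauer polynomials as Gram kernels *)

Definition dotf (R : pzRingType) (n : nat) (x y : 'I_n -> R) : R := \sum_i x i * y i.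

(* On the unit sphere of R^d take [b = d - 2]; the normalisation is [gegen b 1 k = 1]. *)
Fixpoint gegen (R : fieldType) (b t : R) (k : nat) : R :=
  if k is k1.+1 then
    (if k1 is k2.+1 then
      ((k1%:R *+ 2 + b) * t * gegen b t k1 - k1%:R * gegen b t k2) / (k1%:R + b)
    else t)
  else 1.

Section Fischer.
Variables (R : rcfType) (n : nat).
Local Notation poly := (mpoly n.+1 R).
Local Notation var i := (mpolyX R (mnm1 i) : poly).
Implicit Types (p q : poly) (x y : 'I_n.+1 -> R).

(** Multiplication by the linear form [linf x] and by the squared norm [nsq] will be adjoint to the
    directional derivative and to the Laplacian. [eul] is Euler's operator, which multiplies a
    homogeneous polynomial by its degree. *)
Definition linf x : poly := \sum_i x i *: var i.
Definition nsq : poly := \sum_i var i * var i.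
Definition dird x p : poly := \sum_i x i *: mderiv i p.
Definition lap p : poly := \sum_i mderiv i (mderiv i p).
Definition eul p : poly := \sum_i var i * mderiv i p.

Lemma mderiv_var i j : mderiv i (var j) = (i == j)%:R%:A.
Proof.
rewrite mderivX mnm1E eq_sym; have [->|_] := eqVneq i j; last by rewrite !scale0r.
congr (_ *: _); rewrite -[RHS]mpolyX0; congr mpolyX.
by apply/mnmP => l; rewrite mnmBE subnn mnm0E.
Qed.

Lemma mderiv_linf i x : mderiv i (linf x) = (x i)%:A.
Proof.
rewrite raddf_sum (bigD1 i)//= big1 ?addr0 => [|j ji].
  by rewrite mderivZ mderiv_var eqxx scale1r.
by rewrite mderivZ mderiv_var eq_sym (negbTE ji) scale0r scaler0.
Qed.

Lemma mderiv_nsq i : mderiv i nsq = var i *+ 2.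
Proof.
rewrite raddf_sum (bigD1 i)//= big1 ?addr0 => [|j ji].
  by rewrite mderivM mderiv_var eqxx scale1r mul1r mulr1 -mulr2n.
by rewrite mderivM mderiv_var eq_sym (negbTE ji) !scale0r mul0r mulr0 addr0.
Qed.

(** The product rules from here to [lap_nsq] carry [dird], [eul] and [lap] through the recursion for
    [zonal]. *)
Lemma dird_linf x y p : dird y (linf x * p) = dotf x y *: p + linf x * dird y p.
Proof.
rewrite /dird /dotf scaler_suml mulr_sumr -big_split; apply: eq_bigr => i _ /=.
by rewrite mderivM mderiv_linf scalerDr mulr_algl scalerA [y i * _]mulrC -scalerAr.
Qed.

Lemma dird_nsq x p : dird x (nsq * p) = (linf x * p) *+ 2 + nsq * dird x p.
Proof.
rewrite /dird [X in X *+ 2]mulr_suml [X in _ + X]mulr_sumr -sumrMnl -big_split.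
apply: eq_bigr => i _ /=.
by rewrite mderivM mderiv_nsq scalerDr -scalerAr mulrnAl -scalerMnr -scalerAl.
Qed.

Lemma eul_linf x p : eul (linf x * p) = linf x * p + linf x * eul p.
Proof.
rewrite /eul [X in X + _]mulr_suml [X in _ + X]mulr_sumr -big_split.
apply: eq_bigr => i _ /=.
by rewrite mderivM mderiv_linf mulrDr mulr_algl mulrCA -scalerAl -scalerAr.
Qed.

Lemma eul_nsq p : eul (nsq * p) = (nsq * p) *+ 2 + nsq * eul p.
Proof.
rewrite /eul [X in X *+ 2]mulr_suml [X in _ + X]mulr_sumr -sumrMnl -big_split.
apply: eq_bigr => i _ /=.
by rewrite mderivM mderiv_nsq; ring.
Qed.

Lemma lap_linf x p : lap (linf x * p) = linf x * lap p + dird x p *+ 2.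
Proof.
rewrite /lap /dird [X in X + _]mulr_sumr -sumrMnl -big_split; apply: eq_bigr => i _ /=.
rewrite mderivM mderiv_linf mulr_algl mderivD mderivZ mderivM mderiv_linf mulr_algl.
by rewrite addrA addrC mulr2n.
Qed.

Lemma lap_nsq p :
  lap (nsq * p) = nsq * lap p + eul p *+ 4 + p *+ (n.+1).*2.
Proof.
rewrite -muln2 mulnC.
rewrite /lap /eul [X in X + _ + _]mulr_sumr -sumrMnl.
have -> : p *+ (2 * n.+1) = \sum_(i < n.+1) p *+ 2.
  by rewrite sumr_const card_ord mulrnA.
rewrite -!big_split; apply: eq_bigr => i _ /=.
rewrite mderivM mderiv_nsq mderivD !mderivM mderivMn mderiv_nsq mderiv_var eqxx scale1r.
by ring.
Qed.

Lemma mderiv_dird i x p : mderiv i (dird x p) = dird x (mderiv i p).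
Proof.
rewrite /dird raddf_sum; apply: eq_bigr => j _ /=.
by rewrite mderivZ mderiv_comm.
Qed.

Lemma lap_dird x p : lap (dird x p) = dird x (lap p).
Proof.
have -> : dird x (lap p) = \sum_i dird x (mderiv i (mderiv i p)).
  rewrite /lap /dird [RHS]exchange_big; apply: eq_bigr => i _ /=.
  by rewrite (raddf_sum (mderiv i)) scaler_sumr.
by rewrite /lap; apply: eq_bigr => i _; rewrite !mderiv_dird.
Qed.

Lemma dird0 x : dird x 0 = 0.
Proof. by rewrite /dird big1// => i _; rewrite mderiv0 scaler0. Qed.

Lemma dirdD x : {morph dird x : p q / p + q}.
Proof.
move=> p q; rewrite /dird -big_split; apply: eq_bigr => i _ /=.
by rewrite mderivD scalerDr.
Qed.

Lemma dirdZ x c p : dird x (c *: p) = c *: dird x p.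
Proof.
rewrite /dird scaler_sumr; apply: eq_bigr => i _ /=.
by rewrite mderivZ !scalerA mulrC.
Qed.

Lemma eulD : {morph eul : p q / p + q}.
Proof.
move=> p q; rewrite /eul -big_split; apply: eq_bigr => i _ /=.
by rewrite mderivD mulrDr.
Qed.

Lemma eulZ c p : eul (c *: p) = c *: eul p.
Proof.
rewrite /eul scaler_sumr; apply: eq_bigr => i _ /=.
by rewrite mderivZ scalerAr.
Qed.

Lemma lapD : {morph lap : p q / p + q}.
Proof.
move=> p q; rewrite /lap -big_split; apply: eq_bigr => i _ /=.
by rewrite !mderivD.
Qed.

Lemma lapZ c p : lap (c *: p) = c *: lap p.
Proof.
by rewrite /lap scaler_sumr; apply: eq_bigr => i _ /=; rewrite !mderivZ.
Qed.

(** * The Fischer inner product *)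

Definition monoms k := [seq s2m (val t) | t <- enum (basis n.+1 k)].

Lemma mem_monoms k m : (m \in monoms k) = (mdeg m == k).
Proof. by rewrite (basis_cover k m). Qed.

Lemma size_monoms k : size (monoms k) = 'C(k + n, k).
Proof. exact: size_basis. Qed.

Definition mfact (m : multinom n.+1) : R := \prod_i (m i)`!%:R.

(* Only the parts of degree [k] are paired, so the form is bilinear on all polynomials; on degree
   [k] it is the inner product for which multiplication by a variable is adjoint to derivation. *)
Definition fischer k p q : R :=
  \sum_(m <- monoms k) mfact m * mcoeff m p * mcoeff m q.

Lemma fischerC k p q : fischer k p q = fischer k q p.
Proof. by apply: eq_bigr => m _; rewrite mulrAC. Qed.

Lemma fischerDl k p1 p2 q : fischer k (p1 + p2) q = fischer k p1 q + fischer k p2 q.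
Proof.
by rewrite /fischer -big_split; apply: eq_bigr => m _; rewrite mcoeffD mulrDr mulrDl.
Qed.

Lemma fischerZl k c p q : fischer k (c *: p) q = c * fischer k p q.
Proof.
rewrite /fischer mulr_sumr; apply: eq_bigr => m _ /=.
by rewrite mcoeffZ; ring.
Qed.

Lemma fischer_suml k (I : Type) (r : seq I) (F : I -> poly) q :
  fischer k (\sum_(i <- r) F i) q = \sum_(i <- r) fischer k (F i) q.
Proof.
elim: r => [|i r IH]; last by rewrite !big_cons fischerDl IH.
by rewrite !big_nil /fischer big1// => m _; rewrite mcoeff0 mulr0 mul0r.
Qed.

Lemma mcoeff_var_mul i m p :
  mcoeff m (var i * p) = if m i is 0 then 0 else mcoeff (mnm_sub m (mnm1 i)) p.
Proof.
case mi: (m i) => [|k].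
  apply/eqP; rewrite mcoeff_eq0; apply/negP => /msuppM_le /allpairsP[[m1 m2] /=].
  rewrite msuppX inE => -[/eqP -> _ mE].
  by move: mi; rewrite mE mnmDE mnm1E eqxx.
have mE : m = mnm_add (mnm1 i) (mnm_sub m (mnm1 i)).
  by rewrite addmC submK// lep1mP mi.
by rewrite mulrC {1}mE mcoeffMX.
Qed.

Lemma mfactD1 m i : mfact (mnm_add m (mnm1 i)) = (m i).+1%:R * mfact m.
Proof.
rewrite /mfact (bigD1 i)//= [in RHS](bigD1 i)//= mulrA -natrM -factS.
congr (_ * _); first by rewrite mnmDE mnm1E eqxx addn1.
by apply: eq_bigr => j ji; rewrite mnmDE mnm1E eq_sym (negbTE ji) addn0.
Qed.

Lemma perm_monomsS k (i : 'I_n.+1) :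
  perm_eq [seq m : multinom n.+1 <- monoms k.+1 | m i != 0%N]
    [seq mnm_add m (mnm1 i) | m <- monoms k].
Proof.
apply: uniq_perm.
- exact/filter_uniq/uniq_basis.
- by rewrite map_inj_uniq ?uniq_basis// => m1 m2 /addIm.
move=> m; rewrite mem_filter mem_monoms; apply/andP/mapP => [[mi dm]|[m' + ->]].
  have mE : m = mnm_add (mnm_sub m (mnm1 i)) (mnm1 i).
    by rewrite submK// lep1mP.
  exists (mnm_sub m (mnm1 i)) => //.
  by move: dm; rewrite mem_monoms {1}mE mdegD mdeg1 addn1.
by rewrite !mem_monoms mdegD mdeg1 addn1 mnmDE mnm1E eqxx addn1 => /eqP ->.
Qed.

(** The factor [(m i).+1] that derivation puts on a coefficient is the ratio of the weights [mfact]
    of the two monomials. *)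
Lemma fischer_var k i p q : fischer k.+1 (var i * p) q = fischer k p (mderiv i q).
Proof.
rewrite /fischer (bigID (fun m : multinom n.+1 => m i != 0%N))/=.
rewrite [X in _ + X]big1 ?addr0 => [|m /negPn/eqP mi]; last first.
  by rewrite mcoeff_var_mul mi mulr0 mul0r.
rewrite -big_filter (perm_big _ (perm_monomsS k i)) big_map; apply: eq_bigr => m _ /=.
rewrite mcoeff_var_mul mnmDE mnm1E eqxx addn1 addmK mfactD1 mcoeff_deriv.
by rewrite -mulr_natr; ring.
Qed.

Lemma fischer_linf k x p q : fischer k.+1 (linf x * p) q = fischer k p (dird x q).
Proof.
rewrite /linf mulr_suml fischer_suml fischerC /dird fischer_suml.
apply: eq_bigr => i _.
by rewrite -scalerAl !fischerZl fischer_var fischerC.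
Qed.

Lemma fischer_nsq k p q : fischer k.+2 (nsq * p) q = fischer k p (lap q).
Proof.
rewrite /nsq mulr_suml fischer_suml fischerC /lap fischer_suml.
apply: eq_bigr => i _.
by rewrite -mulrA !fischer_var fischerC.
Qed.

(* The harmonic projection of [linf x ^+ k], scaled so that [dird x] maps [zonal x k] to
   [k *: zonal x k.-1]. *)
Fixpoint zonal x k : poly :=
  if k is k1.+1 then
    (if k1 is k2.+1 then
      (k1%:R + (n.+1%:R - 2))^-1 *:
        ((k1%:R *+ 2 + (n.+1%:R - 2)) *: (linf x * zonal x k1)
         - k1%:R *: (nsq * zonal x k2))
    else linf x)
  else 1.

Hypothesis n2 : (2 <= n)%N.
Let b : R := n.+1%:R - 2.

Let b_gt0 : 0 < b.
Proof. by rewrite /b subr_gt0 ltr_nat ltnS. Qed.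

Lemma zonalSS x k : zonal x k.+2 = (k.+1%:R + b)^-1 *:
  ((k.+1%:R *+ 2 + b) *: (linf x * zonal x k.+1) + - k.+1%:R *: (nsq * zonal x k)).
Proof. by rewrite /= scaleNr. Qed.

(** The recursion of [zonal] solved for the product. At [k = 0] the second coefficient vanishes, so
    the default index [k.-1] is harmless. *)
Lemma linf_zonal x k : linf x * zonal x k =
  ((k%:R + b) / (k%:R *+ 2 + b)) *: zonal x k.+1 +
  (k%:R / (k%:R *+ 2 + b)) *: (nsq * zonal x k.-1).
Proof.
case: k => [|k]; first by rewrite mul0rn add0r divff ?gt_eqF// mul0r scale0r addr0 scale1r mulr1.
rewrite zonalSS; apply/mpolyP => m; rewrite !(mcoeffD, mcoeffZ, mcoeffMn).
have k0 := ler0n R k; have b0 := b_gt0.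
by field; apply/andP; split; apply: lt0r_neq0; lra.
Qed.

(** The three properties need each other: the Laplacian of [linf x * zonal x k.+1] produces
    [dird x], that of [nsq * zonal x k] produces [eul]. *)
Lemma zonal_spec x k : dotf x x = 1 ->
  [/\ lap (zonal x k) = 0, eul (zonal x k) = k%:R *: zonal x k &
      dird x (zonal x k) = k%:R *: zonal x k.-1].
Proof.
move=> x1.
have lap1 : lap 1 = 0 :> poly.
  by rewrite /lap big1// => i _; rewrite -mpolyC1 !mderivC ?mderiv0.
have eul1 : eul 1 = 0 :> poly.
  by rewrite /eul big1// => i _; rewrite -mpolyC1 mderivC mulr0.
have dird1 y : dird y 1 = 0 :> poly.
  by rewrite /dird big1// => i _; rewrite -mpolyC1 mderivC scaler0.
(* The recursion reaches two indices back, so the induction carries two consecutive degrees. *)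
suff: [/\ lap (zonal x k) = 0, eul (zonal x k) = k%:R *: zonal x k &
      dird x (zonal x k) = k%:R *: zonal x k.-1] /\
    [/\ lap (zonal x k.+1) = 0, eul (zonal x k.+1) = k.+1%:R *: zonal x k.+1 &
      dird x (zonal x k.+1) = k.+1%:R *: zonal x k].
  by case.
elim: k => [|k [[lk ek dk] [lk1 ek1 dk1]]].
  have zE : zonal x 1 = linf x * 1 by rewrite mulr1.
  split; first by rewrite /= lap1 eul1 dird1 !scale0r.
  rewrite zE lap_linf eul_linf dird_linf lap1 eul1 !dird1 x1.
  by rewrite !mulr0 mul0rn !addr0 !scale1r.
have k0 := ler0n R k; have b0 := b_gt0; split=> //; split.
(* Both surviving terms are multiples of [zonal x k]; they cancel because [n.+1 = b + 2]. *)
- rewrite zonalSS lapZ lapD !lapZ lap_linf lap_nsq lk lk1 ek dk1.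
  rewrite !mulr0 !add0r; apply/mpolyP => m.
  rewrite !(mcoeffD, mcoeffZ, mcoeffMn, mcoeff0) -muln2 -[_ *+ (_ * 2)]mulr_natr natrM /b.
  ring.
- rewrite zonalSS eulZ eulD !eulZ eul_linf eul_nsq ek ek1 -!scalerAr; apply/mpolyP => m.
  rewrite !(mcoeffD, mcoeffZ, mcoeffMn).
  by field; apply: lt0r_neq0; lra.
- rewrite zonalSS dirdZ dirdD !dirdZ dird_linf dird_nsq dk dk1 -!scalerAr linf_zonal x1.
  apply/mpolyP => m.
  rewrite !(mcoeffD, mcoeffZ, mcoeffMn).
  by field; rewrite -?andbA; repeat (apply/andP; split); apply: lt0r_neq0; lra.
Qed.

(** Product of the leading coefficients in [linf_zonal]: modulo multiples of [nsq], [linf x ^+ k] is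
    [zonal_norm k *: zonal x k]. *)
Definition zonal_norm k : R := \prod_(i < k) ((i%:R + b) / (i%:R *+ 2 + b)).

Lemma zonal_norm_gt0 k : 0 < zonal_norm k.
Proof.
apply: prodr_gt0 => i _; apply: divr_gt0; first exact: ltr_wpDl.
by apply: ltr_wpDl => //; rewrite mulrn_wge0.
Qed.

(** Multiples of [nsq] are orthogonal to harmonic polynomials, since [nsq] is adjoint to [lap];
    against a harmonic [p] only the [zonal] part of [linf x ^+ k] counts. *)
Lemma fischer_zonal_harmonic x k p : dotf x x = 1 -> lap p = 0 ->
  zonal_norm k * fischer k (zonal x k) p = fischer k (linf x ^+ k) p.
Proof.
move=> x1; pose P k := forall p, lap p = 0 ->
  zonal_norm k * fischer k (zonal x k) p = fischer k (linf x ^+ k) p.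
suff: P k /\ P k.+1 by case=> + _; apply.
have P0 : P 0%N by move=> q _; rewrite /zonal_norm big_ord0 mul1r expr0.
have step j q : lap q = 0 -> P j ->
    zonal_norm j.+1 * fischer j.+1 (zonal x j.+1) q = fischer j.+1 (linf x ^+ j.+1) q.
  (* [dird x q] is again harmonic, so the hypothesis in degree [j] applies to it. *)
  move=> q0 Pj; rewrite exprS fischer_linf -Pj ?lap_dird ?q0 ?dird0//.
  rewrite -fischer_linf linf_zonal fischerDl !fischerZl.
  rewrite /zonal_norm big_ord_recr; case: j {Pj} => [|j].
    by rewrite !mul0r addr0 mulrA.
  have -> : fischer j.+2 (nsq * zonal x j.+1.-1) q = 0.
    by rewrite fischer_nsq q0 fischerC -[0](scale0r 0) fischerZl mul0r.
  by rewrite mulr0 addr0 mulrA.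
elim: k => [|k [Pk Pk1]]; first by split=> // q q0; exact: step.
by split=> // q q0; exact: step.
Qed.

Lemma linfXS_dird x y k :
  dird y (linf x ^+ k.+1) = (k.+1%:R * dotf x y) *: linf x ^+ k.
Proof.
have dird1 : dird y 1 = 0 :> poly.
  by rewrite /dird big1// => i _; rewrite -mpolyC1 mderivC scaler0.
elim: k => [|k IH].
  by rewrite exprS dird_linf expr0 dird1 mulr0 addr0 mul1r.
rewrite exprS dird_linf IH -scalerAr -exprS -scalerDl; congr (_ *: _).
by ring.
Qed.

Lemma linfXSS_lap x k : dotf x x = 1 ->
  lap (linf x ^+ k.+2) = (k.+2%:R * k.+1%:R) *: linf x ^+ k.
Proof.
move=> x1; have lap1 : lap 1 = 0 :> poly.
  by rewrite /lap big1// => i _; rewrite -mpolyC1 !mderivC ?mderiv0.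
have dird1 : dird x 1 = 0 :> poly.
  by rewrite /dird big1// => i _; rewrite -mpolyC1 mderivC scaler0.
elim: k => [|k IH].
  rewrite exprS lap_linf linfXS_dird -[linf x ^+ 1]mulr1 lap_linf.
  rewrite lap1 dird1 mulr0 mul0rn !addr0 mulr0 add0r x1 -scaler_nat scalerA.
  by congr (_ *: _); rewrite !mulr1.
rewrite exprS lap_linf IH linfXS_dird x1 -scalerAr -exprS -[_ *+ 2]scaler_nat scalerA.
rewrite -scalerDl; congr (_ *: _); rewrite -!natr1; ring.
Qed.

(** Pairing with [linf x ^+ k] is evaluation at [x] up to k factorial. Concretely, moving [linf y]
    and [nsq] across the pairing turns the recursion of [zonal] into that of [gegen]. *)
Lemma fischer_linf_zonal x y k : dotf x x = 1 -> dotf y y = 1 ->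
  fischer k (linf x ^+ k) (zonal y k) = k`!%:R * gegen b (dotf x y) k.
Proof.
move=> x1 y1; pose P k := fischer k (linf x ^+ k) (zonal y k) = k`!%:R * gegen b (dotf x y) k.
suff: P k /\ P k.+1 by case.
have P0 : P 0%N.
  rewrite /P /fischer /monoms /= mulr1.
  have -> : [seq s2m (val t) | t <- enum (basis n.+1 0)] = [:: mnm0].
    apply/perm_small_eq => //; apply: uniq_perm; rewrite ?uniq_basis// => m.
    by rewrite mem_monoms inE mdeg_eq0.
  rewrite big_seq1 mcoeff1 eqxx !mulr1 /mfact big1// => i _.
  by rewrite mnm0E.
elim: k => [|k [Pk Pk1]]; split=> //.
  rewrite /P [zonal _ _]/= [gegen _ _ _]/= mul1r fischerC -[linf y]mulr1 fischer_linf.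
  rewrite linfXS_dird mul1r fischerC fischerZl mulrC.
  by have := P0; rewrite /P /= => ->; rewrite !mul1r.
rewrite /P fischerC zonalSS fischerZl fischerDl !fischerZl fischer_linf fischer_nsq.
rewrite linfXS_dird linfXSS_lap// ![fischer _ (zonal _ _) _]fischerC !fischerZl.
rewrite Pk Pk1 [in RHS]/= -/b !factS !natrM -[(k.+2)%:R]natr1 -/(gegen _ _ k.+1).
have k0 := ler0n R k; have b0 := b_gt0.
by field; apply: lt0r_neq0; lra.
Qed.

(** The kernel is a positive multiple of the pairing of [zonal x k] with [zonal y k]. The features
    are the rescaled coefficients, one for each monomial of degree [k], which also bounds the
    rank. *)
Lemma gegen_features k : exists phi : 'I_('C(k + n, k)) -> ('I_n.+1 -> R) -> R,
  forall x y, dotf x x = 1 -> dotf y y = 1 ->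
    gegen b (dotf x y) k = \sum_d phi d x * phi d y.
Proof.
pose c m := Num.sqrt (mfact m * (zonal_norm k / k`!%:R)).
exists (fun d x => c (nth mnm0 (monoms k) d) * mcoeff (nth mnm0 (monoms k) d) (zonal x k)).
move=> x y x1 y1.
have k0 : k`!%:R != 0 :> R by rewrite pnatr_eq0 -lt0n fact_gt0.
have [ly _ _] := zonal_spec k y1.
apply: (mulfI k0); rewrite -fischer_linf_zonal// -fischer_zonal_harmonic//.
rewrite /fischer (big_nth mnm0) size_monoms big_mkord !mulr_sumr; apply: eq_bigr => d _.
set m := nth _ _ _; have cE : c m * c m = mfact m * (zonal_norm k / k`!%:R).
  rewrite -expr2 sqr_sqrtr// mulr_ge0//.
    by rewrite prodr_ge0// => i _; rewrite ler0n.
  by rewrite divr_ge0 ?ler0n// ltW// zonal_norm_gt0.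
have -> : k`!%:R * (c m * mcoeff m (zonal x k) * (c m * mcoeff m (zonal y k))) =
   k`!%:R * (c m * c m) * (mcoeff m (zonal x k) * mcoeff m (zonal y k)) by ring.
by rewrite cE; field.
Qed.

End Fischer.

(** * The linear programming bound *)

Section Code.
Variable R : rcfType.

(** Cauchy-Schwarz against the constant vector, from the nonnegativity of the variance. *)
Lemma sqr_sum_le (m : nat) (a : 'I_m -> R) :
  (\sum_i a i) ^+ 2 <= m%:R * \sum_i a i ^+ 2.
Proof.
case: m a => [|m] a; first by rewrite !big_ord0 expr0n mul0r.
set A := \sum_i a i; set B := \sum_i _.
have m0 : 0 < m.+1%:R :> R by rewrite ltr0n.
have : 0 <= \sum_i (a i * m.+1%:R - A) ^+ 2 by apply: sumr_ge0 => i _; exact: sqr_ge0.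
under eq_bigr do rewrite sqrrB exprMn.
rewrite big_split sumrB/= -mulr_suml -/B sumr_const card_ord.
rewrite sumrMnl -mulr_suml -mulr_suml -/A.
rewrite -[X in _ + X]mulr_natl => h.
rewrite -(ler_pM2r m0) -subr_ge0; apply: le_trans h _.
by rewrite le_eqVlt; apply/orP; left; apply/eqP; ring.
Qed.

(** The sum is the squared Frobenius norm of the cross matrix between the two families of
    features. *)
Lemma schur_sum_ge0 (M D1 D2 : nat) (phi : 'I_D1 -> 'I_M -> R) (psi : 'I_D2 -> 'I_M -> R) :
  0 <= \sum_i \sum_j (\sum_d phi d i * phi d j) * (\sum_e psi e i * psi e j).
Proof.
suff -> : \sum_i \sum_j (\sum_d phi d i * phi d j) * (\sum_e psi e i * psi e j) =
    \sum_d \sum_e (\sum_i phi d i * psi e i) ^+ 2.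
  by apply: sumr_ge0 => d _; apply: sumr_ge0 => e _; exact: sqr_ge0.
under eq_bigr do under eq_bigr do
  (rewrite mulr_suml; under eq_bigr do rewrite mulr_sumr).
under eq_bigr do rewrite exchange_big.
rewrite exchange_big; apply: eq_bigr => d _.
under eq_bigr do rewrite exchange_big.
rewrite exchange_big; apply: eq_bigr => e _ /=.
rewrite expr2 mulr_suml; apply: eq_bigr => i _.
rewrite mulr_sumr; apply: eq_bigr => j _.
by ring.
Qed.

(** The Gram matrix and the [D] by [D] matrix of feature products have the same trace and Frobenius
    norm. Of the latter only the [D] diagonal entries are kept, and Cauchy-Schwarz is applied to
    them. *)
Lemma gram_rank_bound (M D : nat) (phi : 'I_D -> 'I_M -> R) :
  (\sum_i \sum_d phi d i ^+ 2) ^+ 2 <=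
    D%:R * \sum_i \sum_j (\sum_d phi d i * phi d j) ^+ 2.
Proof.
suff -> : \sum_i \sum_j (\sum_d phi d i * phi d j) ^+ 2 =
    \sum_d \sum_e (\sum_i phi d i * phi e i) ^+ 2.
  rewrite exchange_big; apply: (le_trans (sqr_sum_le _)).
  apply: ler_wpM2l => //; apply: ler_sum => d _.
  have -> : \sum_i phi d i ^+ 2 = \sum_i phi d i * phi d i by apply: eq_bigr => i _; rewrite expr2.
  rewrite [leRHS](bigD1 d)//=.
  by rewrite lerDl sumr_ge0// => e _; exact: sqr_ge0.
under eq_bigr do under eq_bigr do
  (rewrite expr2 mulr_suml; under eq_bigr do rewrite mulr_sumr).
under eq_bigr do rewrite exchange_big.
rewrite exchange_big; apply: eq_bigr => d _.
under eq_bigr do rewrite exchange_big.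
rewrite exchange_big; apply: eq_bigr => e _ /=.
rewrite expr2 mulr_suml; apply: eq_bigr => i _.
rewrite mulr_sumr; apply: eq_bigr => j _.
by ring.
Qed.

Variable b : R.
Hypothesis b_gt0 : 0 < b.

Lemma gegen_recE (t : R) k : t * gegen b t k =
  (k%:R + b) / (k%:R *+ 2 + b) * gegen b t k.+1 +
  k%:R / (k%:R *+ 2 + b) * gegen b t k.-1.
Proof.
case: k => [|k]; first by rewrite mul0rn add0r divff ?gt_eqF// mul0r mul0r addr0 mul1r mulr1.
have k0 := ler0n R k; have b0 := b_gt0.
rewrite -[gegen b t k.+2]/(((k.+1%:R *+ 2 + b) * t * gegen b t k.+1 -
  k.+1%:R * gegen b t k) / (k.+1%:R + b)) -[k.+1.-1]/k.
by field; apply/andP; split; apply: lt0r_neq0; lra.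
Qed.

Lemma gegen1 k : gegen b 1 k = 1.
Proof.
suff: gegen b 1 k = 1 /\ gegen b 1 k.+1 = 1 by case.
elim: k => [//|k [h1 h2]]; split=> //.
rewrite -[LHS]/(((k.+1%:R *+ 2 + b) * 1 * gegen b 1 k.+1 -
  k.+1%:R * gegen b 1 k) / (k.+1%:R + b)) h1 h2.
have k0 := ler0n R k; have b0 := b_gt0.
by field; apply: lt0r_neq0; lra.
Qed.

(** Multiplication by [t] moves each index up and down by one; the zeros of [v] at [K] and [K.+1]
    let both shifted sums keep their range. *)
Lemma gegen_mul_sum (t : R) (v : nat -> R) K : v K = 0 -> v K.+1 = 0 ->
  t * (\sum_(j < K.+1) v j * gegen b t j) =
  \sum_(j < K.+1) ((if j : nat is i.+1 then v i * ((i%:R + b) / (i%:R *+ 2 + b)) else 0) +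
    v j.+1 * (j.+1%:R / (j.+1%:R *+ 2 + b))) * gegen b t j.
Proof.
move=> vK vK1; rewrite mulr_sumr.
transitivity (\sum_(j < K.+1) v j * ((j%:R + b) / (j%:R *+ 2 + b)) * gegen b t j.+1 +
    \sum_(j < K.+1) v j * (j%:R / (j%:R *+ 2 + b)) * gegen b t j.-1).
  rewrite -big_split; apply: eq_bigr => j _ /=.
  by rewrite mulrCA gegen_recE mulrDr !mulrA.
under [RHS]eq_bigr do rewrite mulrDl.
rewrite [RHS]big_split/=; congr (_ + _).
  by rewrite big_ord_recr/= vK !mul0r addr0 big_ord_recl/= mul0r add0r.
by rewrite big_ord_recl/= !(mul0r, mulr0) add0r [RHS]big_ord_recr/= vK1 !mul0r addr0.
Qed.

End Code.

(* Truncated subtraction makes [u] vanish outside the window.  Inside it,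
   [u (j - 1) + u (j + 1) = 2 * u j - 2] and [u j >= L - 1]; the powers of [mu] balance the two
   unequal off-diagonal coefficients [al] and [be]. *)
Lemma window_coef_ge (R : rcfType) (k L : nat) (al be eps s mu : R) (f g : nat -> R)
    (u := fun j => ((j - k) * (k + L - j))%N%:R : R) (v := fun j => mu ^+ j * u j) :
  (2 <= L)%N -> 0 < be -> al = be * mu ^+ 2 -> 0 < mu -> 0 < eps ->
  (forall i, 0 <= f i) -> (forall i, 0 <= g i) ->
  (forall i, (k <= i < k + L)%N -> al <= f i) ->
  (forall i, (k <= i <= k + L)%N -> be <= g i) ->
  s + eps <= 2 * (be * mu) * (1 - (L.-1)%:R^-1) ->
  forall j, eps * v j <= (if j is i.+1 then v i * f i else 0) + v j.+1 * g j.+1 - s * v j.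
Proof.
move=> L2 be0 alE mu0 eps0 f0 g0 fal gbe seps j.
have v0 i : 0 <= v i by apply: mulr_ge0; [exact/exprn_ge0/ltW | exact: ler0n].
have A0 : 0 <= (if j is i.+1 then v i * f i else 0) + v j.+1 * g j.+1.
  apply: addr_ge0; last exact: mulr_ge0.
  by case: j => // i; exact: mulr_ge0.
(* Outside the open window [u j = 0], and only the nonnegative neighbours remain. *)
have [/andP[kj jL]|out] := boolP ((k < j) && (j < k + L))%N; last first.
  suff vj0 : v j = 0 by rewrite vj0 !mulr0 subr0.
  rewrite /v /u (_ : _ * _ = 0)%N ?mulr0//; apply/eqP; rewrite muln_eq0 !subn_eq0.
  by move: out; rewrite negb_and -!leqNgt.
case: j kj jL {A0} => // j kj jL.
rewrite lerBrDr -mulrDl addrC.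
(* As [al = be * mu ^+ 2], both neighbours carry the common factor [be * mu * mu ^+ j.+1]. *)
apply: le_trans (_ : be * mu * mu ^+ j.+1 * (u j + u j.+2) <= _).
  have uge : 2 * (1 - (L.-1)%:R^-1) * u j.+1 <= u j + u j.+2.
    have -> : u j + u j.+2 = 2 * u j.+1 - 2.
      rewrite /u.
      have -> : (j.+1 - k)%N = (j - k).+1 by lia.
      have -> : (j.+2 - k)%N = (j - k).+2 by lia.
      have -> : (k + L - j)%N = (k + L - j.+2).+2 by lia.
      have -> : (k + L - j.+1)%N = (k + L - j.+2).+1 by lia.
      by rewrite !natrM -!natr1; ring.
    have L0 : 0 < (L.-1)%:R :> R by rewrite ltr0n; lia.
    have : (L.-1)%:R <= u j.+1 by rewrite /u ler_nat; nia.
    rewrite -(ler_pM2l (_ : 0 < (L.-1)%:R^-1)) ?invr_gt0// mulVf ?gt_eqF// => h.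
    by lra.
  have w0 : 0 < mu ^+ j.+1 by rewrite exprn_gt0.
  have u0 : 0 <= u j.+1 by rewrite ler0n.
  have : (s + eps) * u j.+1 <= be * mu * (u j + u j.+2).
    apply: (le_trans (ler_wpM2r u0 seps)).
    apply: le_trans (ler_wpM2l (ltW (mulr_gt0 be0 mu0)) uge).
    by rewrite le_eqVlt; apply/orP; left; apply/eqP; ring.
  rewrite -(ler_pM2l w0) /v => h.
  by apply: le_trans (le_trans h _); rewrite le_eqVlt; apply/orP; left; apply/eqP; ring.
rewrite mulrDr; apply: lerD.
  apply: le_trans (_ : v j * al <= _).
    by rewrite /v alE exprS; rewrite le_eqVlt; apply/orP; left; apply/eqP; ring.
  by rewrite ler_wpM2l// fal//; lia.
apply: le_trans (_ : v j.+2 * be <= _).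
  by rewrite /v [mu ^+ j.+2]exprS; rewrite le_eqVlt; apply/orP; left; apply/eqP; ring.
by rewrite ler_wpM2l// gbe//; lia.
Qed.

(** Only the window contributes, so Cauchy-Schwarz costs its length [L], which stays bounded as the
    dimension grows, instead of [K.+1]. *)
Lemma sum_support_le (R : rcfType) (k L K : nat) (v : nat -> R) : K = (k + L)%N ->
  (forall j, ~~ (k <= j < k + L)%N -> v j = 0) ->
  (\sum_(j < K.+1) v j) ^+ 2 <= L%:R * \sum_(j < K.+1) v j ^+ 2.
Proof.
move=> -> v0.
have E (F : nat -> R) : (forall j, ~~ (k <= j < k + L)%N -> F j = 0) ->
    \sum_(j < (k + L).+1) F j = \sum_(i < L) F (k + i)%N.
  move=> F0; rewrite big_ord_recr/= F0 ?addr0; last by rewrite ltnn andbF.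
  rewrite big_split_ord/= big1 ?add0r// => i _; apply: F0.
  by rewrite leqNgt ltn_ord.
rewrite (E v)// (E (fun j => v j ^+ 2)); first exact: sqr_sum_le.
by move=> j /v0 ->; rewrite expr0n.
Qed.

(** The sum [T] is estimated from above by its diagonal in the code points and from below by its
    diagonal in the degrees. [be * mu ^+ 2] and [be] bound the upward and downward recursion
    coefficients on the window. *)
Lemma spherical_code_lp (R : rcfType) (n k L M : nat) (s eps be mu : R)
    (x : 'I_M -> 'I_n.+1 -> R) (b := n.+1%:R - 2 : R) :
  (2 <= n)%N -> (2 <= L)%N -> 0 < be -> 0 < mu -> 0 < eps -> s <= 1 ->
  (forall i, dotf (x i) (x i) = 1) ->
  (forall i j, i != j -> dotf (x i) (x j) <= s) ->
  (forall i, (k <= i < k + L)%N -> be * mu ^+ 2 <= (i%:R + b) / (i%:R *+ 2 + b)) ->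
  (forall i, (k <= i <= k + L)%N -> be <= i%:R / (i%:R *+ 2 + b)) ->
  s + eps <= 2 * (be * mu) * (1 - (L.-1)%:R^-1) ->
  M%:R * eps <= (1 - s) * L%:R * 'C(k + L + n, k + L)%:R.
Proof.
move=> n2 L2 be0 mu0 eps0 s1 x1 xs hal hbe hs.
have b0 : 0 < b by rewrite /b subr_gt0 ltr_nat ltnS.
pose u j : R := ((j - k) * (k + L - j))%N%:R.
pose v j := mu ^+ j * u j.
pose f (i : nat) := (i%:R + b) / (i%:R *+ 2 + b).
pose g (i : nat) := i%:R / (i%:R *+ 2 + b).
have den0 (i : nat) : 0 < i%:R *+ 2 + b by rewrite ltr_wpDl// mulrn_wge0.
have f0 i : 0 <= f i by rewrite divr_ge0// ?ltW// ltr_wpDl.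
have g0 i : 0 <= g i by rewrite divr_ge0// ?ltW.
pose w j := (if j is i.+1 then v i * f i else 0) + v j.+1 * g j.+1 - s * v j.
have wv j : eps * v j <= w j by exact: (@window_coef_ge _ _ _ (be * mu ^+ 2) be).
have v0 j : 0 <= v j by apply: mulr_ge0; [exact/exprn_ge0/ltW | exact: ler0n].
have w0 j : 0 <= w j by apply: le_trans (wv j); rewrite mulr_ge0// ltW.
set K := (k + L)%N.
have vout j : ~~ (k < j < K)%N -> v j = 0.
  move=> jk; rewrite /v /u (_ : _ * _ = 0)%N ?mulr0//.
  by apply/eqP; rewrite muln_eq0 !subn_eq0; move: jk; rewrite negb_and -!leqNgt.
have vK : v K = 0 by rewrite vout// ltnn andbF.
have vK1 : v K.+1 = 0 by rewrite vout//; lia.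
pose p t := \sum_(j < K.+1) v j * gegen b t j.
have pE t : (t - s) * p t = \sum_(j < K.+1) w j * gegen b t j.
  rewrite mulrBl gegen_mul_sum// mulr_sumr -sumrB; apply: eq_bigr => j _.
  by rewrite [s * (_ * _)]mulrA -mulrBl.
pose S i j := \sum_a \sum_c gegen b (dotf (x a) (x c)) i * gegen b (dotf (x a) (x c)) j.
have Sge0 i j : 0 <= S i j.
  have [phi hphi] := gegen_features R n2 i.
  have [psi hpsi] := gegen_features R n2 j.
  have -> : S i j = \sum_a \sum_c
      (\sum_d phi d (x a) * phi d (x c)) * (\sum_e psi e (x a) * psi e (x c)).
    by apply: eq_bigr => a _; apply: eq_bigr => c _; rewrite hphi// hpsi.
  exact: (schur_sum_ge0 (fun d a => phi d (x a)) (fun d a => psi d (x a))).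
have Sjj j : M%:R ^+ 2 <= 'C(j + n, j)%:R * S j j.
  have [phi hphi] := gegen_features R n2 j.
  have -> : M%:R = \sum_a \sum_d phi d (x a) ^+ 2.
    have -> : M%:R = \sum_(a < M) (1 : R) by rewrite sumr_const card_ord.
    apply: eq_bigr => a _; have := hphi _ _ (x1 a) (x1 a).
    by rewrite x1 gegen1// => ->; apply: eq_bigr => d _; rewrite expr2.
  have -> : S j j = \sum_a \sum_c (\sum_d phi d (x a) * phi d (x c)) ^+ 2.
    by apply: eq_bigr => a _; apply: eq_bigr => c _; rewrite hphi// expr2.
  exact: (gram_rank_bound (fun d a => phi d (x a))).
pose T := \sum_a \sum_c (dotf (x a) (x c) - s) * p (dotf (x a) (x c)) ^+ 2.
have Tle : T <= M%:R * ((1 - s) * (\sum_(j < K.+1) v j) ^+ 2).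
  have -> : M%:R * ((1 - s) * (\sum_(j < K.+1) v j) ^+ 2) =
      \sum_(a < M) (1 - s) * (\sum_(j < K.+1) v j) ^+ 2.
    by rewrite sumr_const card_ord mulr_natl.
  apply: ler_sum => a _; rewrite (bigD1 a)//= x1.
  have -> : p 1 = \sum_(j < K.+1) v j.
    by apply: eq_bigr => j _; rewrite gegen1// mulr1.
  rewrite gerDl sumr_le0// => c ca.
  by rewrite mulr_le0_ge0 ?sqr_ge0// subr_le0 xs// eq_sym.
have TE : T = \sum_(i < K.+1) \sum_(j < K.+1) w i * v j * S i j.
  transitivity (\sum_a \sum_c \sum_(i < K.+1) \sum_(j < K.+1)
      w i * v j * (gegen b (dotf (x a) (x c)) i * gegen b (dotf (x a) (x c)) j)).
    apply: eq_bigr => a _; apply: eq_bigr => c _.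
    rewrite expr2 mulrA pE mulr_suml; apply: eq_bigr => i _.
    by rewrite mulr_sumr; apply: eq_bigr => j _; ring.
  under eq_bigr do rewrite exchange_big.
  rewrite exchange_big; apply: eq_bigr => i _ /=.
  under eq_bigr do rewrite exchange_big.
  rewrite exchange_big; apply: eq_bigr => j _ /=.
  by rewrite /S mulr_sumr; apply: eq_bigr => a _; rewrite mulr_sumr.
(* The largest number of monomials among the degrees [j <= K]. *)
set D : R := 'C(K + n, K)%:R.
have D0 : 0 < D by rewrite ltr0n bin_gt0 leq_addr.
set V := \sum_(j < K.+1) v j ^+ 2.
have V0 : 0 < V.
  (* At the index [k.+1] the weight [u] is [L - 1], which is positive. *)
  have kK : (k.+1 < K.+1)%N by rewrite /K; lia.
  rewrite /V (bigD1 (Ordinal kK))//= ltr_pwDl ?sumr_ge0// => [|j _]; last exact: sqr_ge0.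
  rewrite exprn_gt0// mulr_gt0 ?exprn_gt0// ltr0n muln_gt0 !subn_gt0 ltnSn/=.
  by lia.
(* Terms with [i != j] are dropped by [Sge0]; on the diagonal, [w j >= eps * v j] and the rank bound
   apply. *)
have Tge : eps * M%:R ^+ 2 * V <= D * T.
  rewrite TE mulr_sumr /V mulr_sumr; apply: ler_sum => j _.
  rewrite (bigD1 j)//= mulrDr.
  have h : 0 <= D * \sum_(i < K.+1 | i != j) w j * v i * S j i.
    by rewrite mulr_ge0 ?(ltW D0)// sumr_ge0// => i _; rewrite mulr_ge0// mulr_ge0.
  apply: le_trans (_ : D * (w j * v j * S j j) <= _); last by rewrite lerDl.
  have Sj : M%:R ^+ 2 <= D * S j j.
    apply: (le_trans (Sjj j)); rewrite ler_wpM2r// ler_nat.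
    rewrite -[leqLHS]bin_sub ?leq_addr// -[leqRHS]bin_sub ?leq_addr// !addKn.
    by apply: leq_bin2l; rewrite leq_add2r -ltnS.
  apply: le_trans (_ : eps * v j * v j * (D * S j j) <= _).
    have -> : eps * M%:R ^+ 2 * v j ^+ 2 = eps * v j * v j * M%:R ^+ 2 by ring.
    by apply: ler_wpM2l Sj; apply: mulr_ge0 => //; apply: mulr_ge0 => //; exact: ltW.
  have -> : D * (w j * v j * S j j) = w j * v j * (D * S j j) by ring.
  by rewrite ler_wpM2r// ?mulr_ge0 ?(ltW D0)// ler_wpM2r.
have vsum : (\sum_(j < K.+1) v j) ^+ 2 <= L%:R * V.
  apply: (@sum_support_le _ k L K) => // j jk; apply: vout; apply: contra jk.
  by move=> /andP[/ltnW -> ->].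
case: (posnP M) => [->|M0].
  by rewrite mul0r mulr_ge0 ?ler0n// mulr_ge0 ?ler0n// subr_ge0.
have M0' : 0 < M%:R :> R by rewrite ltr0n.
rewrite -(ler_pM2r (mulr_gt0 M0' V0)).
apply: (le_trans (_ : _ <= D * T)).
  by apply: le_trans Tge; rewrite le_eqVlt; apply/orP; left; apply/eqP; ring.
apply: (le_trans (ler_wpM2l (ltW D0) Tle)).
apply: (le_trans (_ : _ <= D * (M%:R * ((1 - s) * (L%:R * V))))).
  by rewrite ler_pM2l// ler_pM2l// ler_wpM2l// subr_ge0.
by rewrite le_eqVlt; apply/orP; left; apply/eqP; ring.
Qed.

(** * Exponential bound for spherical codes *)

(** Equals [(1 + rho) ln (1 + rho) - rho ln rho], the growth rate in natural logarithms of the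
    binomial ['C((1 + rho) n, n)]. *)
Definition code_exponent (R : realType) (rho : R) : R :=
  rho * ln ((1 + rho) / rho) + ln (1 + rho).

(** One term of the binomial expansion of [(1 + rho) ^+ (k + n)] is at most the whole. *)
Lemma bin_le_pow (R : realFieldType) (rho : R) (n k : nat) : 0 < rho ->
  'C(k + n, k)%:R <= ((1 + rho) / rho) ^+ k * (1 + rho) ^+ n.
Proof.
move=> rho0; have r1 : 0 < 1 + rho by lra.
have kn : (k < (k + n).+1)%N by lia.
have : \sum_(i < (k + n).+1) (1 ^+ (k + n - i) * rho ^+ i) *+ 'C(k + n, i) = (1 + rho) ^+ (k + n).
  by rewrite exprDn.
rewrite (bigD1 (Ordinal kn))//= expr1n mul1r => h.
have : rho ^+ k *+ 'C(k + n, k) <= (1 + rho) ^+ (k + n).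
  rewrite -h lerDl sumr_ge0// => i _.
  by rewrite mulrn_wge0// mulr_ge0// exprn_ge0// ?ltW// ler01.
rewrite -mulr_natr exprMn exprVn -mulrA mulrCA -exprD => h'.
by rewrite ler_pdivlMl ?exprn_gt0.
Qed.

(** For degrees near [rho * n] the recursion coefficients tend to [(1 + rho) / (1 + 2 * rho)] and
    [rho / (1 + 2 * rho)], and the strict hypothesis compares [s ^+ 2] with four times their
    product. Its slack pays for [rho' > rho], for [eps] and for the finite length of the window. *)
Lemma window_parameters (R : realType) (rho s : R) : 0 < rho -> 0 <= s <= 1 ->
  s ^+ 2 < 4 * rho * (1 + rho) / (1 + 2 * rho) ^+ 2 ->
  exists rho' mu eps (L : nat), [/\ rho < rho', 0 < mu, 0 < eps, (2 <= L)%N &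
    rho / (1 + 2 * rho) * mu ^+ 2 = (1 + rho') / (1 + 2 * rho') /\
    s + eps <= 2 * (rho / (1 + 2 * rho) * mu) * (1 - (L.-1)%:R^-1)].
Proof.
move=> rho0 /andP[s0 s1] hs; set B := rho / (1 + 2 * rho).
have B0 : 0 < B by rewrite divr_gt0//; lra.
have c0 : 0 < 4 * B * (1 + rho) - s ^+ 2 * (1 + 2 * rho).
  rewrite subr_gt0 -ltr_pdivlMr; last by lra.
  apply: lt_le_trans hs _; rewrite /B le_eqVlt; apply/orP; left; apply/eqP; field; lra.
set c := (X in 0 < X) in c0; pose rho' := rho + c / 4.
have r' : rho < rho' by rewrite /rho'; lra.
pose A := (1 + rho') / (1 + 2 * rho').
have A0 : 0 < A by rewrite divr_gt0//; lra.
have AB : s ^+ 2 < 4 * (A * B).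
  rewrite (_ : 4 * (A * B) = 4 * B * (1 + rho') / (1 + 2 * rho')); last by rewrite /A; field; lra.
  rewrite ltr_pdivlMr; last by lra.
  rewrite -subr_gt0 (_ : _ - _ = c + (4 * B - 2 * s ^+ 2) * (c / 4)); last first.
    by rewrite /rho' /c; ring.
  have s2 : s ^+ 2 <= 1 by rewrite expr_le1.
  have : 0 < B * c by rewrite mulr_gt0.
  have : s ^+ 2 * c <= 1 * c by rewrite ler_pM2r.
  by lra.
(* This makes [B * mu] the geometric mean of [A] and [B], so that [t ^+ 2 = 4 * (A * B)]. *)
pose mu := Num.sqrt (A / B).
have mu0 : 0 < mu by rewrite sqrtr_gt0 divr_gt0.
have mu2 : B * mu ^+ 2 = A.
  have AB0 : 0 <= A / B by rewrite divr_ge0// ltW.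
  by rewrite sqr_sqrtr// mulrC divfK// gt_eqF.
set t := 2 * (B * mu).
have t0 : 0 < t by rewrite mulr_gt0// mulr_gt0.
have st : s < t.
  rewrite -(ltr_pXn2r (_ : 0 < 2)%N) ?nnegrE// ?ltW//; apply: lt_le_trans AB _.
  by rewrite /t -mu2 le_eqVlt; apply/orP; left; apply/eqP; ring.
(* Large enough that the loss [t / m] takes at most half of the gap [t - s]; the other half is
   [eps]. *)
pose m := (Num.truncn (2 * t / (t - s))).+1.
have tm : 2 * t / (t - s) < m%:R by rewrite /m truncnS_gt.
exists rho', mu, ((t - s) / 2), m.+1; split=> //; first by lra.
split=> //; rewrite -/t /=.
have m0 : 0 < m%:R :> R by rewrite ltr0n.
have : t / m%:R <= (t - s) / 2.
  move: tm; rewrite ler_pdivrMr// ltr_pdivrMr; last by lra.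
  by move=> tm; lra.
by lra.
Qed.

(* The binomial is estimated with the parameter [rho0] instead of [rho], which makes the exponent
   linear in [rho - rho0]. *)
Lemma spherical_code_bound (R : realType) (rho0 delta s : R) :
  0 < rho0 -> 0 < delta -> 0 <= s <= 1 ->
  s ^+ 2 = 4 * rho0 * (1 + rho0) / (1 + 2 * rho0) ^+ 2 ->
  exists C n0, 0 < C /\ forall (n M : nat) (x : 'I_M -> 'I_n.+1 -> R), (n0 <= n)%N ->
    (forall i, dotf (x i) (x i) = 1) ->
    (forall i j, i != j -> dotf (x i) (x j) <= s) ->
    M%:R <= C * expR (n%:R * (code_exponent rho0 + delta)).
Proof.
move=> r0 d0 s01 sE.
set A := (1 + rho0) / rho0; set lA := ln A.
have A1 : 1 < A by rewrite /A ltr_pdivlMr//; lra.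
have lA0 : 0 < lA by rewrite ln_gt0.
(* Passing from [rho0] to [rho] raises [rho * lA] by exactly [delta] and makes the condition on [s]
   strict. *)
pose rho := rho0 + delta / lA.
have dl : 0 < delta / lA by rewrite divr_gt0.
have rr : rho0 < rho by rewrite /rho; lra.
have rho_gt0 : 0 < rho by lra.
have hs : s ^+ 2 < 4 * rho * (1 + rho) / (1 + 2 * rho) ^+ 2.
  (* The form on the right shows that the expression increases with [x]. *)
  have E (x : R) : 0 < x -> 4 * x * (1 + x) / (1 + 2 * x) ^+ 2 = 1 - ((1 + 2 * x) ^+ 2)^-1.
    by move=> x0; field; lra.
  rewrite sE !E// ltrD2l ltrN2 ltf_pV2 ?posrE ?exprn_gt0//; try lra.
  by rewrite ltr_pXn2r// ?nnegrE; lra.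
have [rho' [mu [eps [L [rr' mu0 eps0 L2 [muE hL]]]]]] := window_parameters rho_gt0 s01 hs.
have [s0 s1] := andP s01.
pose C := L%:R / eps * expR ((1 + L%:R) * lA).
(* From [n0] on, a window of length [L] starting just above [rho * n] ends below [rho' * (n - 1)];
   the offset also gives [2 <= n]. *)
pose n0 := (Num.truncn ((1 + L%:R + rho') / (rho' - rho))).+3.
have C0 : 0 < C.
  by rewrite mulr_gt0 ?expR_gt0// divr_gt0// ltr0n ltnW.
exists C, n0; split=> // n M x nn0 x1 xs.
have nge : 1 + L%:R + rho' <= (rho' - rho) * n%:R.
  rewrite mulrC -ler_pdivrMr ?subr_gt0//.
  apply: le_trans (ltW (truncnS_gt _)) _.
  by rewrite ler_nat; apply: leq_trans nn0; exact: (leq_addl 2).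
pose k := (Num.truncn (rho * n%:R)).+1.
have kge : rho * n%:R <= k%:R by rewrite ltW// truncnS_gt.
have kle : k%:R <= rho * n%:R + 1.
  by rewrite /k -natr1 lerD2r truncn_le mulr_ge0 ?ler0n// ltW.
have n2 : (2 <= n)%N by apply: leq_trans nn0.
have bE : n.+1%:R - 2 = n%:R - 1 :> R by rewrite -natr1; ring.
have n1 : 1 <= n%:R - 1 :> R by have : 2 <= n%:R :> R; [rewrite ler_nat | lra].
have be0 : 0 < rho / (1 + 2 * rho) by rewrite divr_gt0//; lra.
have hal i : (k <= i < k + L)%N -> rho / (1 + 2 * rho) * mu ^+ 2 <=
    (i%:R + (n.+1%:R - 2)) / (i%:R *+ 2 + (n.+1%:R - 2)).
  move=> /andP[ki]; rewrite -(ltr_nat R) natrD => ikL.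
  have i0 := ler0n R i.
  rewrite bE muE ler_pdivlMr; last by lra.
  rewrite mulrAC ler_pdivrMr; last by lra.
  rewrite -subr_ge0 (_ : _ - _ = rho' * (n%:R - 1) - i%:R); last by ring.
  by lra.
have hbe i : (k <= i <= k + L)%N -> rho / (1 + 2 * rho) <=
    i%:R / (i%:R *+ 2 + (n.+1%:R - 2)).
  move=> /andP[+ _]; rewrite -(ler_nat R) => ki.
  have i0 := ler0n R i.
  rewrite bE ler_pdivlMr; last by lra.
  rewrite mulrAC ler_pdivrMr; last by lra.
  rewrite -subr_ge0 (_ : _ - _ = i%:R - rho * (n%:R - 1)); last by ring.
  by lra.
have := spherical_code_lp n2 L2 be0 mu0 eps0 s1 x1 xs hal hbe hL.
rewrite -ler_pdivlMr// => h; apply: (le_trans h) => {h}.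
(* As [k <= rho * n + 1], rounding and the window cost only the factor [expR ((1 + L%:R) * lA)],
   which is independent of [n]. *)
have hbin : 'C(k + L + n, k + L)%:R <=
    expR ((1 + L%:R) * lA) * expR (n%:R * (code_exponent rho0 + delta)).
  apply: le_trans (bin_le_pow _ _ r0) _.
  rewrite -[X in X ^+ (k + L)](@lnK _ A) ?posrE; last by lra.
  rewrite -[X in _ * X ^+ n](@lnK _ (1 + rho0)) ?posrE; last by lra.
  rewrite -!expRM_natl -!expRD ler_expR -/lA.
  rewrite /code_exponent -/A -/lA natrD -subr_ge0.
  have -> : delta = delta / lA * lA by rewrite divfK// gt_eqF.
  rewrite (_ : _ - _ = (1 + rho * n%:R - k%:R) * lA); last by rewrite /rho; ring.
  by apply: mulr_ge0; [lra | exact: ltW].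
rewrite ler_pdivrMr//.
have -> : C * expR (n%:R * (code_exponent rho0 + delta)) * eps =
    L%:R * (expR ((1 + L%:R) * lA) * expR (n%:R * (code_exponent rho0 + delta))).
  by rewrite /C; field; rewrite gt_eqF.
rewrite -[leLHS]mulrA; apply: le_trans (ler_wpM2l (ler0n R L) hbin).
by rewrite ler_piMl ?mulr_ge0//; lra.
Qed.

(** * Volumes of lp-balls *)

Lemma measurable_affine (R : realType) (a c : R) :
  measurable_fun setT (fun x : measurableTypeR R => (x - c) / a : measurableTypeR R).
Proof. by apply: measurable_funM => //; apply: measurable_funB. Qed.

(** The pushforward divided by [a] gives half-open intervals their length, so it is Lebesgue measure
    by uniqueness. *)
Lemma lebesgue_measure_affine (R : realType) (a c : R) (A : set (measurableTypeR R)) :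
  0 < a -> measurable A ->
  lebesgue_measure ((fun x : measurableTypeR R => (x - c) / a : measurableTypeR R) @^-1` A) =
  (a%:E * lebesgue_measure A)%E.
Proof.
move=> a0 mA.
pose f (x : measurableTypeR R) : measurableTypeR R := (x - c) / a.
have mf : measurable_fun setT f by exact: measurable_affine.
have ai0 : 0 <= a^-1 by rewrite invr_ge0 ltW.
pose m1 := measure_function_pushforward__canonical__measure_function_Measure lebesgue_measure mf.
pose m2 : {measure set (measurableTypeR R) -> \bar R} := mscale (NngNum ai0) m1.
have h : lebesgue_measure A = m2 A.
  apply: lebesgue_measure_unique => // _ [[x y]] _ <- /=.
  rewrite /mscale/= /pushforward.
  have -> : f @^-1` `]x, y]%classic = `](a * x + c), (a * y + c)]%classic.
    apply/seteqP; split => z /=; rewrite !in_itv/= /f.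
      by rewrite ltr_pdivlMr// ler_pdivrMr// ![_ * a]mulrC ltrBrDr lerBlDr.
    by rewrite ltr_pdivlMr// ler_pdivrMr// ![_ * a]mulrC ltrBrDr lerBlDr.
  rewrite !lebesgue_measure_itv/= !lte_fin ltrD2r ltr_pM2l//.
  case: ifPn => _; last by rewrite mule0.
  rewrite -!EFinB -EFinM; congr (_%:E).
  by field; rewrite gt_eqF.
rewrite h /m2 /mscale/= muleA -EFinM divff ?gt_eqF// mul1e//.
Qed.

Definition affine_tuple (R : realType) (a : R) (n : nat) (c : 'I_n -> R)
    (t : n.-tuple (measurableTypeR R)) : n.-tuple (measurableTypeR R) :=
  [tuple (tnth t i - c i) / a | i < n].

Lemma measurable_affine_tuple (R : realType) (a : R) (n : nat) (c : 'I_n -> R) :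
  measurable_fun setT (affine_tuple a c).
Proof.
apply/measurable_fun_tnthP => i.
rewrite (_ : _ \o _ = (fun x : measurableTypeR R => (x - c i) / a : measurableTypeR R) \o
  (fun t : n.-tuple (measurableTypeR R) => tnth t i)); last first.
  by apply/funext => t /=; rewrite tnth_mktuple.
apply: measurableT_comp; first exact: measurable_affine.
exact: measurable_tnth.
Qed.

(** Induction on the dimension: the rescaled pushforward agrees with the product measure on
    rectangles, hence everywhere. *)
Lemma lebesgue_tuple_affine (R : realType) (a : R) (n : nat) (c : 'I_n -> R)
    (A : set (n.-tuple (measurableTypeR R))) : 0 < a -> measurable A ->
  lebesgue_tuple R n (affine_tuple a c @^-1` A) = ((a ^+ n)%:E * lebesgue_tuple R n A)%E.
Proof.
move=> a0; elim: n c A => [|n IH] c A mA.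
  rewrite expr0 mul1e (_ : _ @^-1` _ = A)//.
  by apply/seteqP; split=> t /=; rewrite [affine_tuple a c t]tuple0 [t]tuple0.
pose c' (i : 'I_n) := c (lift ord0 i).
pose f (z : measurableTypeR R * n.-tuple (measurableTypeR R)) :
    measurableTypeR R * n.-tuple (measurableTypeR R) :=
  ((z.1 - c ord0) / a, affine_tuple a c' z.2).
have mf : measurable_fun setT f.
  apply/measurable_fun_pairP; split => /=.
    exact: (measurableT_comp (measurable_affine a (c ord0))).
  exact: (measurableT_comp (measurable_affine_tuple a c')).
have fE z : affine_tuple a c (tuple_of_pair z) = tuple_of_pair (f z).
  apply: eq_from_tnth => i; rewrite tnth_mktuple.
  case: (unliftP ord0 i) => [j ->|->]; last by [].
  by rewrite !tnthS tnth_mktuple.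
pose mu := lebesgue_tuple R n; pose nu : {measure set _ -> \bar R} := (lebesgue_measure \x mu)%E.
have ai0 : 0 <= (a ^+ n.+1)^-1 by rewrite invr_ge0 exprn_ge0// ltW.
have an0 : a ^+ n.+1 != 0 by rewrite gt_eqF// exprn_gt0.
pose m1 := measure_function_pushforward__canonical__measure_function_Measure nu mf.
pose m2 : {measure set (measurableTypeR R * n.-tuple (measurableTypeR R)) -> \bar R} :=
  mscale (NngNum ai0) m1.
have mA' : measurable (@tuple_of_pair R n @^-1` A).
  by rewrite -[X in measurable X]setTI; exact: measurable_tuple_of_pair.
rewrite [LHS]/= [in RHS]/= /lebesgue_tupleS /pushforward.
have -> : (lebesgue_measure \x mu)%E (@tuple_of_pair R n @^-1` A) =
    m2 (@tuple_of_pair R n @^-1` A).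
  apply: product_measure_unique => // B D mB mD.
  rewrite -[LHS]/(((a ^+ n.+1)^-1)%:E * (lebesgue_measure \x mu)
    (((fun x : measurableTypeR R => ((x - c ord0) / a)%R : measurableTypeR R) @^-1` B) `*`
      (affine_tuple a c' @^-1` D)))%E.
  rewrite product_measure1E//; last 2 first.
  - by rewrite -[X in measurable X]setTI; exact: measurable_affine.
  - by rewrite -[X in measurable X]setTI; exact: measurable_affine_tuple.
  rewrite [X in (_ * (X * _))%E](lebesgue_measure_affine (c ord0) a0 mB) [X in (_ * (_ * X))%E]IH//.
  have E (x y : \bar R) : (((a ^+ n.+1)^-1)%:E * ((a%:E * x) * ((a ^+ n)%:E * y)) = x * y)%E.
    rewrite -(muleA a%:E x) (muleCA x) !muleA -!EFinM -mulrA -exprS mulVf// mul1e//.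
  exact: E.
rewrite /m2 /mscale/= /pushforward muleA -EFinM divff// mul1e.
congr ((lebesgue_measure \x mu)%E _).
by apply/seteqP; split=> z /=; rewrite fE.
Qed.

(** Here [r] bounds the p-th power of the distance: the ball of radius [r] is obtained by passing
    the p-th power of [r]. *)
Definition pball (R : realType) (p : R) (n : nat) (c : 'rV[R]_n) (r : R) : set 'rV[R]_n :=
  [set x | \sum_(i < n) `|x ord0 i - c ord0 i| `^ p <= r].

Section volumes.
Variables (R : realType) (p : R) (n : nat).
Hypothesis p1 : 1 <= p.
Let p0 : 0 < p. Proof. exact: lt_le_trans p1. Qed.

Let le_powR (x y : R) : 0 <= x -> 0 <= y -> (x `^ p <= y `^ p) = (x <= y).
Proof.
move=> x0 y0; have [xy|yx] := leP x y.
  by rewrite ge0_ler_powR// ?nnegrE// ltW.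
by apply/negbTE; rewrite -ltNge gt0_ltr_powR// nnegrE.
Qed.

Lemma translate_lpball (x : 'rV[R]_n) : translate x (lpball p n) = pball p x 1.
Proof.
have lpE (y : 'rV[R]_n) : (lpnorm p y <= 1) = (\sum_(i < n) `|y ord0 i| `^ p <= 1).
  have s0 : 0 <= \sum_(i < n) `|y ord0 i| `^ p.
    by apply: sumr_ge0 => i _; exact: powR_ge0.
  rewrite /lpnorm -le_powR ?powR_ge0//.
  by rewrite -powRrM mulVf ?gt_eqF// powRr1// powR1.
apply/seteqP; split=> [_ [y + <-]|y] /=.
  rewrite /lpball/= lpE /pball/= => h.
  by under eq_bigr do rewrite mxE addrAC subrr add0r.
rewrite /pball/= => h; exists (y - x); last by rewrite addrC subrK.
by rewrite /lpball/= lpE; under eq_bigr do rewrite !mxE.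
Qed.

Let preball (c : 'I_n -> R) (r : R) :=
  [set t : n.-tuple (measurableTypeR R) | \sum_(i < n) `|tnth t i - c i| `^ p <= r].

Let measurable_preball (c : 'I_n -> R) (r : R) : measurable (preball c r).
Proof.
have mf : measurable_fun setT (fun t : n.-tuple (measurableTypeR R) =>
    \sum_(i < n) `|tnth t i - c i| `^ p).
  apply: measurable_sum => i.
  apply: (measurableT_comp (measurable_powR p)).
  apply: measurableT_comp => //.
  apply: measurable_funB => //.
  exact: measurable_tnth.
rewrite (_ : preball c r = (fun t : n.-tuple (measurableTypeR R) =>
    \sum_(i < n) `|tnth t i - c i| `^ p) @^-1` `]-oo, r]%classic).
  by rewrite -[X in measurable X]setTI; apply: mf => //; exact: measurable_itv.
by apply/seteqP; split=> t /=; rewrite in_itv.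
Qed.

Definition rowset (A : set 'rV[R]_n) : set (n.-tuple (measurableTypeR R)) :=
  [set t | A (\row_i tnth t i)].

Lemma volE A : vol A = lebesgue_tuple R n (rowset A).
Proof. by []. Qed.

Lemma rowset_pball c r : rowset (pball p c r) = preball (fun i => c ord0 i) r.
Proof.
have E t : \sum_(i < n) `|(\row_j tnth t j) ord0 i - c ord0 i| `^ p =
    \sum_(i < n) `|tnth t i - c ord0 i| `^ p by apply: eq_bigr => i _; rewrite mxE.
by apply/seteqP; split=> t; rewrite /rowset /pball /preball/= E.
Qed.

Lemma measurable_pball c r : measurable (rowset (pball p c r)).
Proof. by rewrite rowset_pball; exact: measurable_preball. Qed.

Lemma vol_pball (c : 'rV[R]_n) (r : R) : 0 < r ->
  vol (pball p c (r `^ p)) = ((r ^+ n)%:E * vol (pball p (0 : 'rV[R]_n)%R 1%R))%E.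
Proof.
move=> r0; rewrite !volE.
rewrite -(@lebesgue_tuple_affine _ r n (fun i => c ord0 i) _ r0 (measurable_pball _ _)).
congr (lebesgue_tuple R n _); rewrite !rowset_pball.
have E (t : n.-tuple (measurableTypeR R)) :
    \sum_(i < n) `|tnth (affine_tuple r (fun i => c ord0 i) t) i - (0 : 'rV[R]_n) ord0 i| `^ p =
    (\sum_(i < n) `|tnth t i - c ord0 i| `^ p) / r `^ p.
  rewrite mulr_suml; apply: eq_bigr => i _.
  rewrite tnth_mktuple mxE subr0 normrM normfV (gtr0_norm r0) powRM ?normr_ge0 ?invr_ge0 ?(ltW r0)//.
  by rewrite -[r^-1]powR_inv1 ?(ltW r0)// -powRrM mulN1r powRN.
by apply/seteqP; split=> t; rewrite /preball/= E ler_pdivrMr ?powR_gt0// mul1r.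
Qed.

Lemma vol_cube (r : R) : 0 <= r -> vol (cube n r) = ((2 * r) ^+ n)%:E.
Proof.
move=> r0; rewrite volE.
rewrite (_ : rowset _ = [set t : n.-tuple (measurableTypeR R) |
    forall i, `[- r, r]%classic (tnth t i)]); last first.
  by apply/seteqP; split=> t; rewrite /rowset /cube/= => h i; have := h i; rewrite mxE in_itv.
rewrite (lebesgue_tuple_box (A := fun=> `[- r, r]%classic)) => [|i]; last exact: measurable_itv.
have -> : lebesgue_measure (`[- r, r]%classic : set (measurableTypeR R)) = (2 * r)%:E.
  rewrite lebesgue_measure_itv/= lte_fin; case: ifPn => [_|].
    by rewrite -EFinB opprK mulr_natl mulr2n.
  by rewrite -leNgt => rr; congr (_%:E); lra.
by rewrite prodEFin prodr_const card_ord.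
Qed.

Lemma measurable_cube (r : R) : measurable (rowset (cube n r)).
Proof.
rewrite (_ : rowset _ = \bigcap_(i in [set: 'I_n])
   ((@tnth n (measurableTypeR R) ^~ i) @^-1` `[- r, r]%classic)); last first.
  apply/seteqP; split=> t /= h i; first by move=> _; have := h i; rewrite mxE /= ?in_itv.
  by rewrite mxE; have := h i Logic.I; rewrite /= ?in_itv.
apply: fin_bigcap_measurable => [|i _]; first exact: finite_finset.
by rewrite -[X in measurable X]setTI; apply: measurable_tnth => //; exact: measurable_itv.
Qed.

Lemma pball_cube (c : 'rV[R]_n) (r s : R) : 0 <= r -> cube n s c ->
  pball p c (r `^ p) `<=` cube n (s + r).
Proof.
move=> r0 sc x; rewrite /pball/= => h i; rewrite -ler_norml.
have : `|x ord0 i - c ord0 i| <= r.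
  rewrite -le_powR//; apply: le_trans h; rewrite (bigD1 i)//= lerDl.
  by apply: sumr_ge0 => j _; exact: powR_ge0.
have := sc i; rewrite -ler_norml => h1 h2.
by rewrite -[x ord0 i](subrK (c ord0 i)) addrC (le_trans (ler_normD _ _))// lerD.
Qed.

Lemma pball_center (c x : 'rV[R]_n) (r : R) : pball p c r x = pball p x r c.
Proof. by rewrite /pball/=; under eq_bigr do rewrite distrC. Qed.

Lemma cube_pball : (0 < n)%N -> cube n (n%:R^-1) `<=` pball p 0 1.
Proof.
move=> n0 x h; rewrite /pball/=.
apply: (@le_trans _ _ (\sum_(i < n) n%:R^-1)); last first.
  by rewrite sumr_const card_ord -[leLHS]mulr_natr mulVf ?gt_eqF// ltr0n.
apply: ler_sum => i _; rewrite mxE subr0; have := h i; rewrite -ler_norml => hi.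
have [->|x0] := eqVneq (x ord0 i) 0; first by rewrite normr0 powR0 ?gt_eqF// invr_ge0.
apply: (le_trans _ hi); apply: ge1r_powR => //; rewrite normr_gt0 x0/=.
by apply: (le_trans hi); rewrite invf_le1 ?ltr0n// ler1n.
Qed.

(** Comparison with the cubes of half-sides [1 / n] and 1. The value cancels in the density bound,
    so positivity and finiteness suffice. *)
Lemma vol_unit_pball : (0 < n)%N ->
  exists2 v : R, 0 < v & vol (pball p (0 : 'rV[R]_n) 1) = v%:E.
Proof.
move=> n0.
set B := pball p (0 : 'rV[R]_n) 1.
have lo : (((2 * n%:R^-1) ^+ n)%:E <= vol B)%E.
  rewrite -vol_cube ?invr_ge0 ?ler0n// !volE; apply: le_measure; rewrite ?inE.
  - exact: measurable_cube.
  - exact: measurable_pball.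
  - by move=> t; apply: (cube_pball n0).
have hi : (vol B <= ((2 * 1) ^+ n)%:E)%E.
  rewrite -vol_cube// !volE; apply: le_measure; rewrite ?inE.
  - exact: measurable_pball.
  - exact: measurable_cube.
  - have -> : B = pball p 0 (1 `^ p) by rewrite powR1.
    have c0 : cube n 0 (0 : 'rV[R]_n) by move=> i; rewrite mxE oppr0 lexx.
    by move=> t /(pball_cube ler01 c0); rewrite add0r.
have l0 : 0 < (2 * n%:R^-1 : R) ^+ n by rewrite exprn_gt0// mulr_gt0// invr_gt0 ltr0n.
have Bfin : vol B \is a fin_num.
  by rewrite ge0_fin_numE ?(le_lt_trans hi) ?ltry// (le_trans _ lo)// lee_fin ltW.
exists (fine (vol B)); last by rewrite fineK.
by rewrite -lte_fin fineK// (lt_le_trans _ lo)// lte_fin.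
Qed.
End volumes.

(** * Density from local counts *)

Lemma limf_esup_le (R : realType) (T : choiceType) (X : filteredType T)
    (f : X -> \bar R) (F : set (set X)) (l : R) :
  (forall e : R, 0 < e -> F [set x | (f x <= (l + e)%:E)%E]) ->
  (limf_esup f F <= l%:E)%E.
Proof.
move=> h; apply/lee_addgt0Pr => e e0.
apply: ge_ereal_inf; exists (ereal_sup (f @` [set x | (f x <= (l + e)%:E)%E])).
  by exists [set x | (f x <= (l + e)%:E)%E] => //; exact: h.
by rewrite -EFinD; apply: ge_ereal_sup => _ [x /= + <-].
Qed.

Section density.
Variables (R : realType) (p : R) (n : nat) (r B : R) (X : set 'rV[R]_n).
Hypotheses (p1 : 1 <= p) (n0 : (0 < n)%N) (r0 : 0 < r) (B0 : 0 <= B).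
Hypothesis count : forall (z : 'rV[R]_n) (M : nat) (x : 'I_M -> 'rV[R]_n),
  injective x -> (forall a, X (x a)) -> (forall a, pball p z (r `^ p) (x a)) -> M%:R <= B.

(** Double counting: the balls of radius [r] covering a given point have their centres in the ball
    of radius [r] around it, so there are at most [B] of them. Integrating over the enlarged cube
    gives the bound. *)
Lemma total_volume_le (M : nat) (x : 'I_M -> 'rV[R]_n) (s : R) : 0 <= s ->
  injective x -> (forall a, X (x a)) -> (forall a, cube n s (x a)) ->
  (\sum_(a < M) vol (pball p (x a) (r `^ p)) <= (B * (2 * (s + r)) ^+ n)%:E)%E.
Proof.
move=> s0 xi xX xs.
pose mu := lebesgue_tuple R n.
pose D a := rowset (pball p (x a) (r `^ p)).
have mD a : measurable (D a) by exact: measurable_pball.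
pose K := rowset (cube n (s + r)).
have mK : measurable K by exact: measurable_cube.
have -> : (\sum_(a < M) vol (pball p (x a) (r `^ p)))%E =
    (\int[mu]_t \sum_(a < M) (\1_(D a) t)%:E)%E.
  rewrite ge0_integral_sum//.
  - by apply: eq_bigr => a _; rewrite volE integral_indic// setIT.
  - by move=> a; apply/measurable_EFinP; exact: measurable_indic.
have -> : ((B * (2 * (s + r)) ^+ n)%:E = \int[mu]_t (B * \1_K t)%:E)%E.
  under eq_integral do rewrite EFinM.
  rewrite ge0_integralZl//; last by apply/measurable_EFinP; exact: measurable_indic.
  by rewrite integral_indic// setIT EFinM -vol_cube// addr_ge0// ltW.
apply: ge0_le_integral => //.
- by move=> t _; apply: sume_ge0 => a _; rewrite lee_fin.
- by apply: emeasurable_sum => a; apply/measurable_EFinP; exact: measurable_indic.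
- apply/measurable_EFinP; apply: measurable_funM => //; exact: measurable_indic.
move=> t _; rewrite sumEFin lee_fin.
pose S := [set a : 'I_M | t \in D a]%SET.
have SE : \sum_(a < M) \1_(D a) t = #|S|%:R :> R.
  rewrite -sum1_card natr_sum [RHS]big_mkcond/=; apply: eq_bigr => a _.
  by rewrite indicE inE; case: (t \in D a).
rewrite SE; have [S0|/card_gt0P[a]] := posnP #|S|; first by rewrite S0 mulr_ge0.
rewrite inE => /set_mem ta.
have -> : \1_K t = 1 :> R.
  rewrite indicE mem_set// /K /rowset/=.
  exact: (pball_cube p1 (ltW r0) (xs a) ta).
rewrite mulr1; pose z : 'rV[R]_n := \row_i tnth t i.
apply: (count (z := z) (x := fun i => x (enum_val i))) => [i j /xi /enum_val_inj//|i|i] //.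
by have := enum_valP i; rewrite inE => /set_mem; rewrite /D /rowset/= pball_center.
Qed.

Lemma count_cube (v : R) (M : nat) (x : 'I_M -> 'rV[R]_n) (s : R) : 
  vol (pball p (0 : 'rV[R]_n) 1) = v%:E -> 0 <= s ->
  injective x -> (forall a, X (x a)) -> (forall a, cube n s (x a)) ->
  M%:R * v <= B / r ^+ n * (2 * (s + r)) ^+ n.
Proof.
move=> vE s0 xi xX xs; have := total_volume_le s0 xi xX xs.
under eq_bigr do rewrite vol_pball// vE -EFinM.
rewrite sumEFin sumr_const card_ord lee_fin => h.
rewrite mulrAC ler_pdivlMr ?exprn_gt0//; apply: le_trans h.
by rewrite -mulr_natl le_eqVlt; apply/orP; left; apply/eqP; ring.
Qed.

(** Infinitely many centres would contain an injective family too large for [count_cube]. *)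
Lemma finite_centers (s : R) : 0 <= s -> finite_set (X `&` cube n s).
Proof.
move=> s0; have [v v0 vE] := vol_unit_pball p1 n0.
apply: contrapT => /infiniteP/pcard_leP[f].
pose M := (Num.truncn (B / r ^+ n * (2 * (s + r)) ^+ n / v)).+1.
have fX k : (X `&` cube n s) (f k) by exact: (@funS _ _ setT).
have fi : injective (fun a : 'I_M => f a).
  by move=> a b /(@inj _ _ setT f); rewrite !inE => /(_ Logic.I Logic.I)/val_inj.
have := @count_cube v M (fun a => f a) s vE s0 fi (fun a => (fX a).1) (fun a => (fX a).2).
apply/negP; rewrite -ltNge -ltr_pdivrMr//.
exact: truncnS_gt.
Qed.

(** Unit balls that meet the cube have their centres in the cube enlarged by 1; their number times
    the unit volume is what [count_cube] bounds. *)
Lemma covered_volume_le (s : R) : 0 <= s ->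
  (vol (cube n s `&` \bigcup_(x in X) translate x (lpball p n)) <=
    (B / r ^+ n * (2 * (s + 1 + r)) ^+ n)%:E)%E.
Proof.
move=> s0; have s1 : 0 <= s + 1 by rewrite addr_ge0.
have [v v0 vE] := vol_unit_pball p1 n0.
have /finite_seqP[l0 lE] := finite_centers s1.
pose l := undup l0.
have lP x : (x \in l) <-> (X `&` cube n (s + 1)) x by rewrite lE /= mem_undup.
pose x (a : 'I_(size l)) := nth 0 l a.
have xX a : (X `&` cube n (s + 1)) (x a) by apply/lP; exact: mem_nth.
have xi : injective x.
  by move=> a b /eqP; rewrite nth_uniq ?undup_uniq// => /eqP/val_inj.
have E : cube n s `&` \bigcup_(x in X) translate x (lpball p n) =
    \bigcup_(a in [set: 'I_(size l)]) (cube n s `&` pball p (x a) 1).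
  apply/seteqP; split=> [y [sy [c Xc]]|y [a _ [sy xy]]].
    rewrite translate_lpball// => cy.
    have cs : cube n (s + 1) c.
      by apply: (pball_cube p1 ler01 sy); rewrite powR1 pball_center.
    have /lP cl : (X `&` cube n (s + 1)) c by [].
    have il : (index c l < size l)%N by rewrite index_mem.
    by exists (Ordinal il) => //; split=> //; rewrite /x /= nth_index.
  by split=> //; exists (x a); [exact: (xX a).1 | rewrite translate_lpball].
pose D a := rowset (cube n s `&` pball p (x a) 1).
have mD a : measurable (D a).
  by apply: measurableI; [exact: measurable_cube | exact: measurable_pball].
have vD a : (lebesgue_tuple R n (D a) <= v%:E)%E.
  have <- : vol (pball p (x a) 1) = v%:E.
    have -> : pball p (x a) 1 = pball p (x a) (1 `^ p) by rewrite powR1.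
    by rewrite vol_pball// expr1n mul1e.
  apply: le_measure; rewrite ?inE//; first exact: measurable_pball.
  by move=> t [].
rewrite E volE.
have mU : measurable (\bigcup_(a in [set: 'I_(size l)]) D a) by exact: fin_bigcup_measurable.
have UD : rowset (\bigcup_(a in [set: 'I_(size l)]) (cube n s `&` pball p (x a) 1)) =
    \bigcup_(a in [set: 'I_(size l)]) D a by [].
apply: (@le_trans _ _ (\sum_(a \in [set: 'I_(size l)]) lebesgue_tuple R n (D a))%E).
  apply: content_sub_fsum; [exact: finite_finset|by move=> a _|exact: mU|by []].
have -> : [set: 'I_(size l)] = [set` index_enum 'I_(size l)].
  by apply/seteqP; split=> a //= _; exact: mem_index_enum.
rewrite -fsbig_seq ?index_enum_uniq//.
apply: (@le_trans _ _ (\sum_(a < size l) v%:E)%E); first exact: lee_sum.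
rewrite sumEFin lee_fin sumr_const card_ord -[leLHS]mulr_natl.
exact: (count_cube vE s1 xi (fun a => (xX a).1) (fun a => (xX a).2)).
Qed.

Lemma density_le : (density p X <= (B / r ^+ n)%:E)%E.
Proof.
apply: limf_esup_le => e e0.
set D := B / r ^+ n.
have D0 : 0 <= D by rewrite divr_ge0// exprn_ge0// ltW.
(* Beyond [s0] the boundary factor is at most [expR y = 1 + e / (D + 1)], which adds at most [e] to
   [D]; the summand 1 covers [D = 0]. *)
pose y := ln (1 + e / (D + 1)).
have y0 : 0 < y by rewrite ln_gt0// ltrDl divr_gt0//; lra.
pose s0 := n%:R * (1 + r) / y.
have s00 : 0 < s0.
  by apply: divr_gt0 => //; apply: mulr_gt0; [rewrite ltr0n | exact: addr_gt0].
exists s0; split; first exact: num_real.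
move=> s ss /=.
have s_gt0 : 0 < s by exact: lt_trans ss.
apply: (@le_trans _ _ (((2 * s) ^- n)%:E * (D * (2 * (s + 1 + r)) ^+ n)%:E)%E).
  rewrite lee_pmul2l ?lte_fin ?invr_gt0 ?exprn_gt0 ?mulr_gt0//.
  by apply: covered_volume_le; exact: ltW.
rewrite -EFinM lee_fin.
have -> : (2 * s) ^- n * (D * (2 * (s + 1 + r)) ^+ n) = D * (1 + (1 + r) / s) ^+ n.
  rewrite mulrCA -exprVn -exprMn; congr (_ * _ ^+ _); field.
  by rewrite gt_eqF.
have h : (1 + (1 + r) / s) ^+ n <= 1 + e / (D + 1).
  rewrite -[leRHS]lnK ?posrE; last by rewrite addr_gt0// divr_gt0//; lra.
  rewrite -/y; apply: (@le_trans _ _ (expR ((1 + r) / s) ^+ n)).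
    have q0 : 0 <= (1 + r) / s by apply/ltW/divr_gt0 => //; exact: addr_gt0.
    by rewrite lerXn2r ?nnegrE ?expR_ge0 ?expR_ge1Dx// addr_ge0.
  rewrite -expRM_natl ler_expR mulrA ler_pdivrMr// [leRHS]mulrC -ler_pdivrMr//.
  exact: ltW.
apply: (le_trans (ler_wpM2l D0 h)).
rewrite mulrDr mulr1 lerD2l mulrA ler_pdivrMr; last by lra.
by rewrite mulrC ler_wpM2l ?ltW// ltrDl.
Qed.
End density.

(** * From lp-packings to spherical codes *)

Lemma powR_convex (R : realType) (q l a b : R) : 1 <= q -> 0 <= l <= 1 -> 0 <= a -> 0 <= b ->
  ((1 - l) * a + l * b) `^ q <= (1 - l) * a `^ q + l * b `^ q.
Proof.
move=> q1 /andP[l0 l1] a0 b0.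
have h : 0 <= 1 - l <= 1 by apply/andP; split; lra.
have := convex_powR q1 (Itv01 (proj1 (andP h)) (proj2 (andP h))) (x := a) (y := b).
rewrite !inE/= !in_itv/= a0 b0 => /(_ isT isT).
have onemE : unstable.onem (1 - l) = l by rewrite /unstable.onem opprB addrC subrK.
by rewrite convRE [X in X `^ _ <= _ -> _]convRE /= onemE.
Qed.

(** Each [c <= s] satisfies [c ^ q <= (c / s) * s ^ q]; adding this for [a] and [b] gives the
    claim. *)
Lemma powR_superadd (R : realType) (q a b : R) : 1 <= q -> 0 <= a -> 0 <= b ->
  a `^ q + b `^ q <= (a + b) `^ q.
Proof.
move=> q1 a0 b0; have q0 : q != 0 by rewrite gt_eqF//; lra.
have [->|an0] := eqVneq a 0; first by rewrite powR0// !add0r.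
have [->|bn0] := eqVneq b 0; first by rewrite powR0// !addr0.
have {an0}a0 : 0 < a by rewrite lt0r an0.
have {bn0}b0 : 0 < b by rewrite lt0r bn0.
set s := a + b; have s0 : 0 < s by rewrite addr_gt0.
have key c : 0 < c -> c <= s -> c `^ q <= c / s * s `^ q.
  move=> c0 cs; rewrite -[X in X `^ q <= _](divfK (lt0r_neq0 s0)).
  apply: ge1r_powRZ => //; last exact: ltW.
  by rewrite divr_gt0//= ler_pdivrMr// mul1r.
have ale : a <= s by rewrite /s lerDl ltW.
have ble : b <= s by rewrite /s lerDr ltW.
apply: le_trans (lerD (key a a0 ale) (key b b0 ble)) _.
by rewrite -mulrDl -mulrDl -/s divff ?gt_eqF// mul1r.
Qed.

Definition spow (R : realType) (q a : R) : R := if 0 <= a then a `^ q else - (- a) `^ q.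

Lemma spow_sqr (R : realType) (q a : R) : spow q a ^+ 2 = `|a| `^ (q * 2).
Proof.
rewrite powRrM powR_mulrn ?powR_ge0// /spow.
by case: ifPn => [a0|]; [rewrite ger0_norm | rewrite -ltNge => a0; rewrite sqrrN ltr0_norm].
Qed.

(** For equal signs this follows from superadditivity, for opposite signs from convexity at the
    midpoint. *)
Lemma spow_sub_ge (R : realType) (q a b : R) : 1 <= q -> b <= a ->
  2 * ((a - b) / 2) `^ q <= spow q a - spow q b.
Proof.
move=> q1 ba; have q0 : q != 0 by rewrite gt_eqF//; lra.
have half c : 0 <= c -> 2 * (c / 2) `^ q <= c `^ q.
  move=> c0; have := @powR_convex R q (1 / 2) 0 c q1 _ (lexx _) c0.
  rewrite powR0// !mulr0 !add0r [1 / 2 * c]mulrC div1r => h.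
  by rewrite -ler_pdivlMl// h// invr_ge0 invf_le1//; lra.
have sup c d : 0 <= d -> d <= c -> 2 * ((c - d) / 2) `^ q <= c `^ q - d `^ q.
  move=> d0 dc; have cd0 : 0 <= c - d by rewrite subr_ge0.
  apply: (le_trans (half _ cd0)); rewrite lerBrDr.
  by apply: le_trans (powR_superadd q1 cd0 d0) _; rewrite subrK.
rewrite /spow; case: ifPn => [a0|/negbTE an]; case: ifPn => [b0|/negbTE bn].
- exact: sup.
- have b0 : b < 0 by rewrite ltNge bn.
  rewrite opprK.
  have nb0 : 0 <= - b by rewrite oppr_ge0 ltW.
  have := @powR_convex R q (1 / 2) a (- b) q1 _ a0 nb0.
  have -> : (1 - 1 / 2) * a + 1 / 2 * - b = (a - b) / 2 by field.
  have -> x y : (1 - 1 / 2) * x + 1 / 2 * y = (x + y) / 2 :> R by field.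
  have h01 : 0 <= (1 / 2 : R) <= 1 by apply/andP; split; lra.
  by move=> /(_ h01) h; lra.
- by rewrite (le_trans b0 ba) in an.
- have a0 : a < 0 by rewrite ltNge an.
  rewrite opprK [leRHS]addrC.
  have -> : a - b = - b - - a by ring.
  by apply: sup; [rewrite oppr_ge0 ltW | rewrite lerN2].
Qed.

(** The constants are such that, summed over the coordinates, [l_p]-distance at least 2 yields
    Euclidean distance at least 2. *)
Lemma spow_sub_sqr_ge (R : realType) (q a b : R) : 1 <= q ->
  4 * (`|a - b| / 2) `^ (q * 2) <= (spow q a - spow q b) ^+ 2.
Proof.
move=> q1.
wlog ba : a b / b <= a.
  move=> h; have [/h//|/ltW/h] := leP b a.
  by rewrite distrC -(opprB (spow q a)) sqrrN.
have d0 : 0 <= a - b by rewrite subr_ge0.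
have h := spow_sub_ge q1 ba.
rewrite ger0_norm// powRrM powR_mulrn ?powR_ge0//.
have -> : 4 * ((a - b) / 2) `^ q ^+ 2 = (2 * ((a - b) / 2) `^ q) ^+ 2 by ring.
have h0 : 0 <= 2 * ((a - b) / 2) `^ q by rewrite mulr_ge0// powR_ge0.
by rewrite lerXn2r ?nnegrE// (le_trans h0).
Qed.

(** After scaling by [w] the images lie in the Euclidean unit ball at mutual distance at least
    [2 * w]. An extra coordinate lifts them to the sphere, where [dotf] is 1 minus half the squared
    distance. *)
Lemma lp_code (R : realType) (p w : R) (n M : nat) (z : 'I_n -> R) (x : 'I_M -> 'I_n -> R) :
  2 <= p -> 0 < w ->
  (forall a, \sum_(i < n) `|x a i - z i| `^ p <= w ^- 2) ->
  (forall a c, a != c -> 2 `^ p <= \sum_(i < n) `|x a i - x c i| `^ p) ->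
  exists y : 'I_M -> 'I_n.+1 -> R,
    (forall a, dotf (y a) (y a) = 1) /\
    (forall a c, a != c -> dotf (y a) (y c) <= 1 - 2 * w ^+ 2).
Proof.
move=> p2 w0 xz xx.
pose q := p / 2; have q1 : 1 <= q by rewrite /q; lra.
have qp : q * 2 = p by rewrite /q; lra.
pose f a i := w * spow q (x a i - z i).
have f1 a : \sum_i f a i ^+ 2 <= 1.
  under eq_bigr do rewrite exprMn spow_sqr qp.
  by rewrite -mulr_sumr mulrC -ler_pdivlMr ?exprn_gt0// div1r.
pose y a i := if unlift ord0 i is Some j then f a j else Num.sqrt (1 - \sum_j f a j ^+ 2).
have y0 a : y a ord0 = Num.sqrt (1 - \sum_j f a j ^+ 2) by rewrite /y unlift_none.
have yS a j : y a (lift ord0 j) = f a j by rewrite /y liftK.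
have yy a : dotf (y a) (y a) = 1.
  rewrite /dotf big_ord_recl y0 -expr2 sqr_sqrtr ?subr_ge0//.
  rewrite [X in _ + X](_ : _ = \sum_j f a j ^+ 2) ?subrK//.
  by apply: eq_bigr => i _; rewrite yS expr2.
exists y; split=> // a c ac.
have E : dotf (y a) (y c) = 1 - (\sum_i (y a i - y c i) ^+ 2) / 2.
  have -> : \sum_i (y a i - y c i) ^+ 2 =
      dotf (y a) (y a) + dotf (y c) (y c) - dotf (y a) (y c) *+ 2.
    rewrite /dotf -sumrMnl -big_split -sumrB/=; apply: eq_bigr => i _.
    by ring.
  by rewrite !yy; field.
rewrite E lerD2l lerN2 ler_pdivlMr//.
(* The extra coordinate is discarded; it can only increase the distance. *)
rewrite big_ord_recl -[leLHS]add0r lerD ?sqr_ge0//.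
apply: le_trans (_ : \sum_i w ^+ 2 * (4 * (`|x a i - x c i| / 2) `^ p) <= _).
  rewrite -mulr_sumr -mulr_sumr [2 * _]mulrC -!mulrA ler_pM2l ?exprn_gt0//.
  rewrite (_ : 2 * 2 = 4 * 1); last by ring.
  rewrite ler_pM2l//.
  under eq_bigr do rewrite powRM ?invr_ge0// -[2^-1]powR_inv1// -powRrM mulN1r powRN.
  by rewrite -mulr_suml ler_pM2l// ler_pdivlMr ?powR_gt0// mul1r xx.
apply: ler_sum => i _; rewrite !yS /f -mulrBr exprMn ler_pM2l ?exprn_gt0//.
rewrite -qp; apply: le_trans (spow_sub_sqr_ge _ _ q1).
rewrite (_ : x a i - z i - (x c i - z i) = x a i - x c i)//.
by ring.
Qed.

(* A point [z] near [m] is split as [z - c = t * ((m - c) / t) + (1 - t) * ((z - m) / (1 - t))], and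
   convexity of the p-th power is applied. *)
Lemma interior_pball (R : realType) (p : R) (n : nat) (c m : 'rV[R]_n) : 1 <= p ->
  \sum_(i < n) `|m ord0 i - c ord0 i| `^ p < 1 -> interior (pball p c 1) m.
Proof.
move=> p1; have p0 : 0 < p by lra.
set S := \sum_(i < n) _ => S1.
have S0 : 0 <= S by apply: sumr_ge0 => i _; exact: powR_ge0.
have SE : S = (S `^ p^-1) `^ p by rewrite -powRrM mulVf ?gt_eqF// powRr1.
(* The lower bound [1 / 2] keeps [t] positive when [S = 0]. *)
pose t := Num.max (S `^ p^-1) (1 / 2).
have t0 : 0 < t by rewrite lt_max; apply/orP; right; lra.
have t1 : t < 1.
  rewrite gt_max; apply/andP; split; last by lra.
  have -> : 1 = 1 `^ p^-1 :> R by rewrite powR1.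
  by rewrite gt0_ltr_powR ?nnegrE ?invr_gt0.
have St : S <= t `^ p.
  by rewrite SE ge0_ler_powR ?nnegrE ?powR_ge0 ?(ltW p0) ?(ltW t0)// le_max lexx.
pose l := 1 - t; have l0 : 0 < l by rewrite /l; lra.
have lt : 1 - l = t by rewrite /l; ring.
(* Balls here are those of the sup norm; with this radius the [n] error terms add up to at most
   [l]. *)
apply/nbhs_ballP; exists (l / n.+1%:R) => /=; first by rewrite divr_gt0.
move=> z mz; rewrite /pball/=.
have zb i : `|z ord0 i - m ord0 i| / l <= n.+1%:R^-1.
  have := mz.2 ord0 i; rewrite /ball/= distrC => /ltW.
  by rewrite ler_pdivrMr// mulrC.
apply: (@le_trans _ _ (\sum_(i < n) (t / t `^ p * `|m ord0 i - c ord0 i| `^ p + l * n.+1%:R^-1))).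
  apply: ler_sum => i _.
  set a := `|m ord0 i - c ord0 i| / t; set b := `|z ord0 i - m ord0 i| / l.
  have a0 : 0 <= a by rewrite divr_ge0// ltW.
  have b0 : 0 <= b by rewrite divr_ge0// ltW.
  have h : `|z ord0 i - c ord0 i| <= (1 - l) * a + l * b.
    rewrite lt /a /b ![_ * (_ / _)]mulrC !divfK ?gt_eqF//.
    have -> : z ord0 i - c ord0 i = (m ord0 i - c ord0 i) + (z ord0 i - m ord0 i) by ring.
    exact: ler_normD.
  have l01 : 0 <= l <= 1 by apply/andP; split; rewrite /l; lra.
  have ab0 : 0 <= (1 - l) * a + l * b by exact: le_trans h.
  apply: (le_trans (ge0_ler_powR (ltW p0) _ _ h)); rewrite ?nnegrE//.
  apply: (le_trans (powR_convex p1 l01 a0 b0)); apply: lerD.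
    rewrite lt /a powRM ?invr_ge0 ?(ltW t0)//.
    rewrite -[t^-1]powR_inv1 ?(ltW t0)// -powRrM mulN1r powRN.
    by rewrite le_eqVlt; apply/orP; left; apply/eqP; ring.
  rewrite ler_wpM2l ?(ltW l0)//; apply: le_trans (zb i); rewrite -/b.
  have [->|bn0] := eqVneq b 0; first by rewrite powR0// gt_eqF.
  apply: ge1r_powR => //; rewrite lt0r bn0 b0/=; apply: (le_trans (zb i)).
  by rewrite invf_le1 ?ltr0n// ler1n.
rewrite big_split/= -mulr_sumr -/S sumr_const card_ord.
rewrite -[leRHS](_ : t + l = 1); last by rewrite /l; ring.
apply: lerD.
  by rewrite -[leRHS]mulr1 -mulrA ler_wpM2l ?(ltW t0)// mulrC ler_pdivrMr ?powR_gt0// mul1r.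
rewrite -[leLHS]mulr_natr -mulrA -[leRHS]mulr1 ler_wpM2l ?(ltW l0)//.
by rewrite ler_pdivrMl// mulr1 ler_nat.
Qed.

(** The midpoint of two closer centres would be interior to both balls. *)
Lemma packing_dist (R : realType) (p : R) (n : nat) (X : set 'rV[R]_n) (x y : 'rV[R]_n) :
  1 <= p -> packing p X -> X x -> X y -> x != y ->
  2 `^ p <= \sum_(i < n) `|x ord0 i - y ord0 i| `^ p.
Proof.
move=> p1 pX Xx Xy; apply: contraNT; rewrite -ltNge => h; apply/eqP.
apply: pX => //; exists (2^-1 *: (x + y)); rewrite !translate_lpball//.
have key (u v : 'rV[R]_n) : \sum_(i < n) `|u ord0 i - v ord0 i| `^ p < 2 `^ p ->
    interior (pball p u 1) (2^-1 *: (u + v)).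
  move=> uv; apply: interior_pball => //.
  rewrite (eq_bigr (fun i => `|u ord0 i - v ord0 i| `^ p * (2 `^ p)^-1)) => [|i _].
    by rewrite -mulr_suml ltr_pdivrMr ?powR_gt0// mul1r.
  rewrite !mxE (_ : _ - _ = (v ord0 i - u ord0 i) / 2); last by field.
  rewrite normrM distrC normfV (ger0_norm (ler0n R 2)) powRM// ?invr_ge0//.
  by rewrite -[2^-1]powR_inv1// -powRrM mulN1r powRN.
split; first exact: key.
by rewrite addrC; apply: key; under eq_bigr do rewrite distrC.
Qed.

Lemma max_density_le (R : realType) (p w B : R) (n : nat) :
  2 <= p -> (0 < n)%N -> 0 < w -> 0 <= B ->
  (forall (M : nat) (x : 'I_M -> 'I_n.+1 -> R),
    (forall a, dotf (x a) (x a) = 1) ->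
    (forall a c, a != c -> dotf (x a) (x c) <= 1 - 2 * w ^+ 2) -> M%:R <= B) ->
  (max_density p n <= (B * (w `^ (2 / p)) ^+ n)%:E)%E.
Proof.
move=> p2 n0 w0 B0 hB; apply: ge_ereal_sup => _ [X pX <-].
have p1 : 1 <= p by lra.
(* At this radius the p-th power is [w ^- 2], as [lp_code] requires. *)
pose r := (w `^ (2 / p))^-1.
have r0 : 0 < r by rewrite invr_gt0 powR_gt0.
have rp : r `^ p = w ^- 2.
  rewrite /r -powRN -powRrM mulNr divfK ?gt_eqF//; last by lra.
  by rewrite powRN powR_mulrn// ltW.
rewrite (_ : B * _ = B / r ^+ n); last by rewrite /r exprVn invrK.
apply: density_le => // z M x xi xX xz.
have xz' a : \sum_(i < n) `|x a ord0 i - z ord0 i| `^ p <= w ^- 2 by rewrite -rp; exact: xz.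
have xd a c : a != c -> 2 `^ p <= \sum_(i < n) `|x a ord0 i - x c ord0 i| `^ p.
  by move=> ac; apply: packing_dist pX (xX a) (xX c) _ => //; rewrite inj_eq.
have [y [y1 yd]] := lp_code p2 w0 xz' xd.
exact: hB y1 yd.
Qed.

(** * Passage to the exponential growth rate *)

Lemma log2e_le (R : realType) (x : \bar R) (c : R) : 0 < c -> (x <= c%:E)%E ->
  (log2e x <= (log2 c)%:E)%E.
Proof.
move=> c0 xc; rewrite /log2e /log2 EFinM; apply: lee_wpmul2r.
  by rewrite lee_fin invr_ge0 ln_ge0// ler1n.
case: x xc => [r|//|_]; last by rewrite leNye.
rewrite lee_fin /= => rc.
case: ifPn => [_|]; first by rewrite leNye.
by rewrite -ltNge => r0; rewrite lee_fin ler_ln// posrE.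
Qed.

Lemma gamma_le (R : realType) (p rho w : R) : 2 <= p -> 0 < rho -> 0 < w ->
  0 <= 1 - 2 * w ^+ 2 <= 1 ->
  (1 - 2 * w ^+ 2) ^+ 2 = 4 * rho * (1 + rho) / (1 + 2 * rho) ^+ 2 ->
  (gamma p <= ((code_exponent rho + 2 / p * ln w) / ln 2)%:E)%E.
Proof.
move=> p2 rho0 w0 w01 wE; have l2 : 0 < ln 2 :> R by rewrite ln_gt0// ltr1n.
apply: limf_esup_le => e e0.
(* Half of [e], in natural logarithms, goes to the code exponent and half to [ln C / n]. *)
pose d := e * ln 2 / 2; have d0 : 0 < d by rewrite divr_gt0// mulr_gt0.
have [C [n0 [C0 hC]]] := spherical_code_bound rho0 d0 w01 wE.
pose n1 := maxn n0.+1 (Num.truncn (`|ln C| / d)).+1.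
exists n1 => // n /= n1n.
have nn0 : (n0 < n)%N by apply: leq_trans n1n; rewrite leq_maxl.
have n_gt0 : 0 < n%:R :> R by rewrite ltr0n; exact: leq_ltn_trans nn0.
have nC : ln C / n%:R <= d.
  rewrite ler_pdivrMr// mulrC -ler_pdivrMr//.
  apply: (@le_trans _ _ (`|ln C| / d)); first by rewrite ler_pM2r ?invr_gt0// ler_norm.
  apply: (le_trans (ltW (truncnS_gt _))); rewrite ler_nat.
  by apply: leq_trans n1n; rewrite leq_maxr.
set A := C * expR (n%:R * (code_exponent rho + d)).
have A0 : 0 < A by rewrite mulr_gt0// expR_gt0.
have wp : 0 < w `^ (2 / p) by rewrite powR_gt0.
have hmax : (max_density p n <= (A * (w `^ (2 / p)) ^+ n)%:E)%E.
  apply: max_density_le => //; [exact: leq_ltn_trans nn0 | exact: ltW|].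
  by move=> M x x1 xx; apply: hC => //; exact: ltnW.
have P0 : 0 < A * (w `^ (2 / p)) ^+ n by rewrite mulr_gt0// exprn_gt0.
have i0 : (0 <= (n%:R^-1)%:E :> \bar R)%E by rewrite lee_fin invr_ge0 ltW.
apply: (le_trans (lee_wpmul2l i0 (log2e_le P0 hmax))).
rewrite -EFinM lee_fin /log2 lnM ?posrE ?exprn_gt0// lnXn// ln_powR.
rewrite /A lnM ?posrE ?expR_gt0// expRK.
rewrite -[2 / p * ln w *+ n]mulr_natl.
set K := code_exponent rho.
have -> : n%:R^-1 * ((ln C + n%:R * (K + d) + n%:R * (2 / p * ln w)) / ln 2) =
    (ln C / n%:R + (K + d + 2 / p * ln w)) / ln 2.
  by field; rewrite !gt_eqF//; lra.
have -> : (K + 2 / p * ln w) / ln 2 + e = (K + 2 / p * ln w + 2 * d) / ln 2.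
  by rewrite /d; field; rewrite !gt_eqF//; lra.
by rewrite ler_pM2r ?invr_gt0//; lra.
Qed.

(** * The angle *)

Lemma cos_half_sin (R : realType) (t : R) : cos t = 1 - 2 * sin (t / 2) ^+ 2.
Proof.
have -> : cos t = cos ((t / 2) *+ 2) by congr cos; rewrite mulr2n; field.
by rewrite cos_mulr2n cos2sin2; ring.
Qed.

Definition angle_bound (R : realType) (p theta : R) : R :=
  (1 + sin theta) / (2 * sin theta) * log2 ((1 + sin theta) / (2 * sin theta))
  - (1 - sin theta) / (2 * sin theta) * log2 ((1 - sin theta) / (2 * sin theta))
  + 2 / p * log2 (sin (theta / 2)).

Lemma angle_boundE (R : realType) (p theta : R)
    (rho := (1 - sin theta) / (2 * sin theta)) :
  0 < sin theta < 1 ->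
  angle_bound p theta = (code_exponent rho + 2 / p * ln (sin (theta / 2))) / ln 2.
Proof.
move=> /andP[s0 s1].
have rho0 : 0 < rho by rewrite divr_gt0// ?subr_gt0// mulr_gt0.
have r1 : (1 + sin theta) / (2 * sin theta) = 1 + rho.
  by rewrite /rho; field; rewrite gt_eqF.
have l2 : ln 2 != 0 :> R by rewrite gt_eqF// ln_gt0// ltr1n.
rewrite /angle_bound r1 -/rho /log2 /code_exponent ln_div ?posrE//; last by lra.
by move: (2 / p) => q; field.
Qed.

Lemma sin_lt1_pihalf (R : realType) (theta : R) : 0 < theta < pi / 2 ->
  [/\ 0 < sin theta < 1, 0 < cos theta & 0 < sin (theta / 2)].
Proof.
move=> /andP[t0 t1].
have s0 : 0 < sin theta by rewrite sin_gt0_pihalf// t0.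
have c0 : 0 < cos theta by apply: cos_gt0_pihalf; apply/andP; split => //; lra.
split=> //; last by apply: sin_gt0_pihalf; apply/andP; split; lra.
rewrite s0/= -(ltr_pXn2r (_ : 0 < 2)%N) ?nnegrE ?ler01 ?(ltW s0)// expr1n.
by rewrite -(cos2Dsin2 theta) ltrDr exprn_gt0.
Qed.

Lemma gamma_le_angle_bound (R : realType) (p theta : R) : 2 <= p -> 0 < theta < pi / 2 ->
  (gamma p <= (angle_bound p theta)%:E)%E.
Proof.
move=> p2 ht; have [hs c0 w0] := sin_lt1_pihalf ht.
rewrite angle_boundE//; have /andP[s0 s1] := hs.
(* Here [w = sin (theta / 2)] makes the code bound [cos theta]. As [1 + 2 * rho = 1 / sin theta],
   the condition on [rho] becomes the identity for [cos theta ^+ 2]. *)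
apply: gamma_le => //; rewrite -?cos_half_sin.
- by rewrite divr_gt0// ?subr_gt0// mulr_gt0.
- by rewrite (ltW c0) cos_le1.
- by rewrite cos2sin2; field; rewrite ?gt_eqF//; lra.
Qed.

Lemma angle_bound_lt (R : realType) (p : R) : 2 <= p ->
  exists2 theta : R, 0 < theta < pi / 2 & angle_bound p theta < - 1 / p.
Proof.
move=> p2.
(* Near [theta = pi / 2] the first two terms are [O(cos theta ^ (3 / 2))], while the last one
   is below [-1 / p] by a multiple of [cos theta / p]; hence the choice [cos theta = (8 * p)^-2]. *)
pose u := (8 * p)^-1.
have u0 : 0 < u by rewrite invr_gt0 mulr_gt0//; lra.
have pu : p^-1 = 8 * u by rewrite /u; field; lra.
have u1 : u <= 1 / 16.
  by rewrite /u div1r lef_pV2 ?posrE ?mulr_gt0//; lra.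
pose c := u ^+ 2.
have c0 : 0 < c by rewrite exprn_gt0.
have c1 : c <= 1 / 256.
  have -> : 1 / 256 = (1 / 16) ^+ 2 :> R by field.
  by rewrite /c lerXn2r ?nnegrE ?(ltW u0)//; lra.
have cI : -1 <= c <= 1 by apply/andP; split; lra.
pose t := acos c.
have ct : cos t = c by rewrite acosK// in_itv/=.
have ht : 0 < t < pi / 2.
  apply/andP; split; first by apply: acos_gt0; apply/andP; split; lra.
  have ti : t \in `[0, pi] by rewrite in_itv/= acos_ge0// acos_lepi.
  have pi2 : (pi / 2 : R) \in `[0, pi].
    by have := pi_ge0 R => h; rewrite in_itv/=; apply/andP; split; lra.
  by rewrite -(ltr_cos ti pi2) cos_pihalf ct.
exists t => //.
have [hs _ w0] := sin_lt1_pihalf ht.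
rewrite angle_boundE//; have /andP[s0 s1] := hs.
have l2 : 0 < ln 2 :> R by rewrite ln_gt0// ltr1n.
rewrite ltr_pdivrMr// /code_exponent.
set rho := (1 - sin t) / (2 * sin t).
have s2 : sin t ^+ 2 = 1 - c ^+ 2 by rewrite -ct sin2cos2.
have rho0 : 0 < rho by rewrite divr_gt0// ?subr_gt0// mulr_gt0.
have sge : 1 / 2 <= sin t by nra.
(* As [2 * sin t >= 1], [rho <= 1 - sin t <= 1 - sin t ^+ 2 = c ^+ 2]. *)
have rhoc : rho <= u ^+ 4.
  have -> : u ^+ 4 = c ^+ 2 by rewrite /c; ring.
  rewrite ler_pdivrMr; last by lra.
  by nra.
have lnw : 2 / p * ln (sin (t / 2)) = p^-1 * (ln (1 - c) - ln 2).
  have wE : sin (t / 2) ^+ 2 = (1 - c) / 2 by have := cos_half_sin t; rewrite ct => ->; field.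
  rewrite -ln_div ?posrE//; last by lra.
  by rewrite -wE lnXn// -[_ *+ 2]mulr_natl; ring.
rewrite lnw.
have lc : ln (1 - c) <= - c by apply: le_ln1Dx; lra.
have l1 : ln (1 + rho) <= rho by apply: le_ln1Dx; lra.
(* The fourth root of [rho] tames the logarithm: [ln (1 + 1 / rho) <= 4 * ln (1 + 1 / k) <= 4 /
   k]. *)
pose k := Num.sqrt (Num.sqrt rho).
have k0 : 0 < k by rewrite !sqrtr_gt0.
have k4 : k ^+ 4 = rho.
  by rewrite (exprM k 2 2) !sqr_sqrtr// ?sqrtr_ge0// ltW.
have ku : k <= u.
  by rewrite -(ler_pXn2r (_ : 0 < 4)%N) ?nnegrE ?(ltW k0) ?(ltW u0)// k4.
have l3 : rho * ln ((1 + rho) / rho) <= 4 * k ^+ 3.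
  have h : ln ((1 + rho) / rho) <= 4 * k^-1.
    have y0 : 0 < k^-1 by rewrite invr_gt0.
    have y1 : 0 < 1 + k^-1 by rewrite addr_gt0.
    apply: (@le_trans _ _ (ln ((1 + k^-1) ^+ 4))).
      have r1 : 0 < (1 + rho) / rho by apply: divr_gt0 => //; lra.
      rewrite ler_ln ?posrE ?exprn_gt0//.
      rewrite mulrDl divff ?(gt_eqF rho0)// div1r -k4 -exprVn.
      move: (k^-1) y0 {y1} => y y0.
      have -> : (1 + y) ^+ 4 = y ^+ 4 + 1 + (4 * y + 6 * y ^+ 2 + 4 * y ^+ 3) by ring.
      by rewrite addrC lerDl !addr_ge0// mulr_ge0// ?exprn_ge0// ltW.
    rewrite lnXn// -[leLHS]mulr_natl ler_wpM2l//; apply: le_ln1Dx.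
    by apply: lt_trans y0; lra.
  apply: (le_trans (ler_wpM2l (ltW rho0) h)).
  rewrite -k4 le_eqVlt; apply/orP; left; apply/eqP; field.
  by rewrite gt_eqF.
have k3 : k ^+ 3 <= u ^+ 3 by rewrite lerXn2r ?nnegrE ?(ltW k0) ?(ltW u0).
have u4 : u ^+ 4 <= u ^+ 3.
  by rewrite [u ^+ 4]exprS ler_piMl ?exprn_ge0 ?(ltW u0)//; lra.
have u3 : 0 < u ^+ 3 by rewrite exprn_gt0.
(* The first two terms contribute at most [4 * u ^+ 3 + u ^+ 3], against a gain of [8 * u ^+ 3] from
   [ln (1 - c)]. *)
rewrite mulNr mul1r mulrBr pu.
have : 8 * u * ln (1 - c) <= 8 * u * (- c) by rewrite ler_wpM2l// mulr_ge0// ltW.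
have -> : 8 * u * (- c) = - 8 * u ^+ 3 by rewrite /c; ring.
by lra.
Qed.

Theorem theorem1p1 (R : realType) :
  (forall p : R, 2 <= p ->
    (gamma p <= ereal_inf
      [set ((1 + sin theta) / (2 * sin theta)
              * log2 ((1 + sin theta) / (2 * sin theta))
            - (1 - sin theta) / (2 * sin theta)
              * log2 ((1 - sin theta) / (2 * sin theta))
            + 2 / p * log2 (sin (theta / 2)))%:E
      | theta in [set theta : R | (0 < theta < pi / 2)%R]])%E) /\
  (forall p : R, 2 <= p -> (gamma p < (- 1 / p)%:E)%E).
Proof.
split=> p p2.
  by apply: le_ereal_inf_tmp => _ [theta ht <-]; exact: gamma_le_angle_bound.
have [theta ht hlt] := angle_bound_lt p2.
by apply: le_lt_trans (gamma_le_angle_bound p2 ht) _; rewrite lte_fin.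
Qed.
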